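(* Let $\boldsymbol\gamma=\{\gamma_n\}_{n=0}^{\infty}$ be a sequence of real numbers. Then the following conditions are equivalent: (i) $\boldsymbol\gamma$ is CPD and there exist $\alpha,\theta\in\mathbb{R}_+$ such that $|\gamma_n|\leq \alpha\,\theta^n$ for all $n\in\mathbb{Z}_+$; (ii) $\boldsymbol\gamma$ is CPD and $\limsup_{n\to\infty}|\gamma_n|^{1/n}<\infty$; (iii) there exist $b\in\mathbb{R}$, $c\in\mathbb{R}_+$ and a finite compactly supported Borel measure $\nu$ on $\mathbb{R}$ such that $\nu(\{1\})=0$ and $$\gamma_n=\gamma_0+bn+cn^2+\int_{\mathbb{R}}Q_n(x)\,\mathrm{d}\nu(x),\quad n\in\mathbb{Z}_+.$$ Moreover, if (iii) holds, then the triplet $(b,c,\nu)$ is unique and (1) $\limsup_{n\to\infty}|\gamma_n|^{1/n}=\inf\{\theta\in\mathbb{R}_+\colon \exists\alpha\in\mathbb{R}_+\ \forall n\in\mathbb{Z}_+\ |\gamma_n|\leq\alpha\,\theta^n\}$; (2) if $c>0$, then $\limsup_{n\to\infty}|\gamma_n|^{1/n}\geq 1$; (3) $\operatorname{supp}(\nu)\subseteq\big[-\limsup_{n\to\infty}|\gamma_n|^{1/n},\ \limsup_{n\to\infty}|\gamma_n|^{1/n}\big]$; (4) if $\sup_{x\in\operatorname{supp}(\nu)}|x|\geq 1$, then $\limsup_{n\to\infty}|\gamma_n|^{1/n}=\sup_{x\in\operatorname{supp}(\nu)}|x|$; (5) $\limsup_{n\to\infty}|\gamma_n|^{1/n}\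leq\max\big\{1,\sup_{x\in\operatorname{supp}(\nu)}|x|\big\}$.
   Context: $\mathbb{Z}_+=\{0,1,2,\ldots\}$, $\mathbb{R}_+=[0,\infty)$. Measures are positive; $\operatorname{supp}(\nu)$ is the closed support of $\nu$; convention: a supremum over the empty set equals $-\infty$. A real sequence $\{\gamma_n\}_{n=0}^\infty$ is conditionally positive definite (CPD) if $\sum_{i,j=0}^k \gamma_{i+j}\lambda_i\bar\lambda_j\geq 0$ for all finite complex sequences $\lambda_0,\ldots,\lambda_k$ with $\sum_{i=0}^k\lambda_i=0$. The polynomials $Q_n$ are defined by $Q_0=Q_1=0$ and $Q_n(x)=\sum_{j=0}^{n-2}(n-j-1)x^j$ for $n\geq 2$. *)

(* Defs.v *)
From HB Require Import structures.
From mathcomp Require Import all_boot all_order all_algebra.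
From mathcomp Require Import all_classical all_reals all_analysis.
From mathcomp Require Import complex.

Set Implicit Arguments.
Unset Strict Implicit.
Unset Printing Implicit Defensive.

Import Order.TTheory GRing.Theory Num.Theory.
Import numFieldNormedType.Exports.

Local Open Scope classical_set_scope.
Local Open Scope ring_scope.
Local Open Scope complex_scope.

(* In [R[i]], [0 <= z] means that [z] is real and nonnegative. *)
Definition cond_pos_def (R : realType) (gamma : R ^nat) : Prop :=
  forall (k : nat) (lambda : 'I_k.+1 -> R[i]),
    \sum_(i < k.+1) lambda i = 0 ->
    0 <= \sum_(i < k.+1) \sum_(j < k.+1)
           (gamma (i + j)%N)%:C * lambda i * (lambda j)^*%C.

(* The sum is empty for n = 0 and n = 1, and runs over 0 <= j <= n - 2
   otherwise. *)
Definition Qpoly (R : realType) (n : nat) : {poly R} :=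
  \sum_(0 <= j < n.-1) (n - j - 1)%:R *: 'X^j.

(* [measurableTypeR R] carries the Borel sigma-algebra of R. *)
Notation borel_finite_measure R :=
  {finite_measure set (measurableTypeR R) -> \bar R}.

Definition msupport (R : realType) (nu : borel_finite_measure R) : set R :=
  [set x | forall U : set R, open U -> U x -> (0 < nu U)%E].

(* The term of index 0 is irrelevant (it equals 1). *)
Definition limsup_root (R : realType) (gamma : R ^nat) : \bar R :=
  limn_esup (fun n => (`|gamma n| `^ (n%:R^-1))%:E).

(* Equal to -oo when the support is empty. *)
Definition sup_abs_support (R : realType) (nu : borel_finite_measure R) :
    \bar R :=
  ereal_sup [set `|x|%:E | x in msupport nu].

Definition represents (R : realType) (gamma : R ^nat) (b c : R)
    (nu : borel_finite_measure R) : Prop :=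
  [/\ 0 <= c, compact (msupport nu), nu [set 1] = 0%E &
      forall n : nat, gamma n = gamma 0%N + b * n%:R + c * n%:R ^+ 2
                      + \int[nu]_x (Qpoly R n).[x : R]].

(* Main.v *)
Require Import Defs.
From HB Require Import structures.
From mathcomp Require Import all_boot all_order all_algebra.
From mathcomp Require Import all_classical all_reals all_analysis.
From mathcomp Require Import measurable_realfun complex ring lra zify.

(* The second difference of gamma is the moment sequence of the measure
   nu + 2c delta_1, and gamma is CPD exactly when this second difference is
   positive definite: a polynomial whose coefficients sum to 0 is a multiple of
   X - 1.  So the theorem is a statement on the compactly supported Hamburger
   moment problem.  If L is a functional on polynomials, nonnegative on squares,
   with |L(X^n)| <= C theta^n, iterating Cauchy-Schwarz gives
   |L(X q^2)| <= theta L(q^2); hence L is nonnegative on the Bernstein basis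
   (theta - X)^j (theta + X)^k.  After rescaling to [0, 1], the Bernstein weights
   define discrete measures; along an ultrafilter their distribution functions
   converge pointwise, and the right limits of the limit are the distribution
   function of a representing measure.  Uniqueness follows by approximating
   indicators of half-lines by the polynomials (1 - u^n)^(K^n). *)

Import Order.TTheory GRing.Theory Num.Theory.
Import numFieldNormedType.Exports.

Set Implicit Arguments.
Unset Strict Implicit.
Unset Printing Implicit Defensive.

Local Open Scope classical_set_scope.
Local Open Scope ring_scope.

(** * Functionals on polynomials and positivity *)

(** The second difference loses growth information below rate 1: a nonzero constant sequence has
    second difference 0. Hence the maxima with 1 in the upper bounds on root growth. In the other
    direction nothing is lost: growth of gamma bounds the moments, and the even moments locate the
    support. The normalization nu({1}) = 0 separates the quadratic term from the measure: 2c is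
    exactly the mass at 1 of the combined measure, and b is then read off at n = 1 because Q_0 = Q_1
    = 0. Roots occur only in identifying the limsup with the infimum of the growth rates; later
    estimates concern rates, and a strict increase of the rate absorbs constants and finitely many
    terms. The ultrafilter gives the limit distribution function at all points at once, without
    diagonal extraction, but with no one-sided continuity. Moments are therefore approximated by
    finite grid sums that are affine in the values of the distribution function, with errors uniform
    in that function; such sums pass to the limit and tolerate the change to right limits. *)

Section MomentFunctional.
Variable R : realType.
Implicit Types (g : R ^nat) (p q : {poly R}).

Lemma bernoulli_ineq (x : R) n : -1 <= x -> 1 + n%:R * x <= (1 + x) ^+ n.
Proof.
move=> x1; elim: n => [|n IH]; first by rewrite mul0r addr0 expr0.
have x0 : 0 <= 1 + x by rewrite -lerBlDl sub0r.
rewrite exprS (le_trans _ (ler_wpM2l x0 IH))// -natr1.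
by have := mulr_ge0 (ler0n R n) (sqr_ge0 x); nra.
Qed.

(** The Riesz functional of the sequence [g]. *)
Definition momf g p : R := \sum_(i < size p) p`_i * g i.

Lemma momfE g n p : (size p <= n)%N -> momf g p = \sum_(i < n) p`_i * g i.
Proof.
move=> pn; rewrite /momf (big_ord_widen n (fun i => p`_i * g i)) //.
rewrite big_mkcond /=; apply: eq_bigr => i _; case: ltnP => // pi.
by rewrite nth_default ?mul0r.
Qed.

Fact momf_linear g : linear_for *%R (momf g).
Proof.
move=> a p q; pose n := maxn (size p) (size q).
rewrite (@momfE _ n) ?(@momfE _ n p) ?(@momfE _ n q) ?leq_maxl ?leq_maxr//.
  rewrite mulr_sumr -big_split /=; apply: eq_bigr => i _.
  by rewrite coefD coefZ mulrDl mulrA.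
rewrite (leq_trans (size_polyD _ _))// geq_max leq_maxr andbT.
by rewrite (leq_trans (size_scale_leq _ _))// leq_maxl.
Qed.

HB.instance Definition _ g :=
  GRing.isLinear.Build R {poly R} R *%R (momf g) (momf_linear g).

Lemma momfXn g n : momf g 'X^n = g n.
Proof.
rewrite /momf size_polyXn big_ord_recr /= big1 ?add0r => [|i _].
  by rewrite coefXn eqxx mul1r.
by rewrite coefXn (ltn_eqF (ltn_ord i)) mul0r.
Qed.

Lemma momfXM g n p : momf g ('X^n * p) = \sum_(i < size p) p`_i * g (n + i)%N.
Proof.
rewrite -{1}(coefK p) poly_def mulr_sumr linear_sum /=; apply: eq_bigr => i _.
by rewrite -scalerAr linearZ /= -exprD momfXn.
Qed.

Section Positive.
Variable g : R ^nat.
Hypothesis gpos : forall q, 0 <= momf g (q ^+ 2).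

Lemma momf_cauchy_schwarz p q :
  momf g (p * q) ^+ 2 <= momf g (p ^+ 2) * momf g (q ^+ 2).
Proof.
have sq (a b : R) : 0 <= a ^+ 2 * momf g (p ^+ 2)
    + 2 * a * b * momf g (p * q) + b ^+ 2 * momf g (q ^+ 2).
  have := gpos (a *: p + b *: q).
  suff -> : (a *: p + b *: q) ^+ 2 = a ^+ 2 *: p ^+ 2 + (2 * a * b) *: (p * q)
      + b ^+ 2 *: q ^+ 2 by rewrite !linearD !linearZ.
  by rewrite -!mul_polyC ?(rmorphM, rmorphXn) /= ?(rmorphM, rmorphXn) /=; ring.
have := gpos p; have := sq (momf g (p * q)) (- momf g (p ^+ 2)).
set A := momf g (p ^+ 2); set B := momf g (p * q); set D := momf g (q ^+ 2).
move=> h; rewrite le_eqVlt => /predU1P[A0|A0]; last first.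
  rewrite -(ler_pM2l A0); nra.
(* If A = 0, the form at (-(D + 1), B) equals -(D + 2) B^2, which forces B = 0. *)
have := sq (- (D + 1)) B; rewrite -/A -/B -/D -A0 => h1.
have D0 : 0 <= D by exact: gpos.
by rewrite mul0r; have := mulr_ge0 (sqr_ge0 B) D0; have := sqr_ge0 B; nra.
Qed.

Variables (C th : R).
Hypothesis th0 : 0 < th.
Hypothesis gth : forall n, `|g n| <= C * th ^+ n.

(** Doubling the index repeatedly makes the constant K of a crude growth bound harmless: K stays
    fixed while the ratio rho = |a m| / (th^m a 0) is raised to the power 2^k, so rho cannot exceed
    1. *)
Lemma momfXM_le m q : `|momf g ('X^m * q ^+ 2)| <= th ^+ m * momf g (q ^+ 2).
Proof.
pose a n := momf g ('X^n * q ^+ 2).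
have a0 : momf g (q ^+ 2) = a 0%N by rewrite /a expr0 mul1r.
have a00 : 0 <= a 0%N by rewrite -a0.
have CS n : `|a n| ^+ 2 <= a 0%N * `|a (n * 2)%N|.
  rewrite real_normK ?num_real// -a0.
  have -> : a n = momf g ('X^n * q * q) by rewrite /a expr2 mulrA.
  apply: le_trans (momf_cauchy_schwarz _ _) _.
  rewrite mulrC ler_wpM2l// exprMn -exprM; exact: ler_norm.
(* The factor [a 0] kept on the left avoids the exponent 2^k - 1 and a division by [a 0], which may
   vanish. *)
have it k : forall n, `|a n| ^+ (2 ^ k) * a 0%N
     <= a 0%N ^+ (2 ^ k) * `|a (n * 2 ^ k)%N|.
  elim: k => [|k IH] n; first by rewrite expn0 !expr1 muln1 mulrC.
  rewrite expnS exprM.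
  apply: (@le_trans _ _ ((a 0%N * `|a (n * 2)%N|) ^+ (2 ^ k) * a 0%N)).
    by rewrite ler_wpM2r// lerXn2r ?nnegrE ?mulr_ge0 ?exprn_ge0.
  rewrite mulnA mul2n -addnn exprD exprMn -!mulrA ler_wpM2l ?exprn_ge0//.
pose K := C * \sum_(i < size (q ^+ 2)) `|(q ^+ 2)`_i| * th ^+ i.
have bd n : `|a n| <= K * th ^+ n.
  rewrite /a momfXM (le_trans (ler_norm_sum _ _ _))// /K mulr_sumr mulr_suml.
  apply: ler_sum => i _; rewrite normrM.
  rewrite (le_trans (ler_wpM2l _ (gth _)))// exprD le_eqVlt; apply/orP; left.
  by apply/eqP; ring.
rewrite a0 -/(a m); move: a00; rewrite le_eqVlt => /predU1P[A0|A0].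
  have := CS m; rewrite -A0 mul0r mulr0 => h.
  by rewrite -(@ler_pXn2r _ 2) ?nnegrE// expr0n.
have thm : 0 < th ^+ m by rewrite exprn_gt0.
rewrite leNgt; apply/negP => lt.
pose rho := `|a m| / (th ^+ m * a 0%N).
have rho1 : 1 < rho by rewrite ltr_pdivlMr ?mulr_gt0// mul1r.
have bnd k : rho ^+ (2 ^ k) <= K / a 0%N.
  rewrite ler_pdivlMr// expr_div_n mulrAC ler_pdivrMr ?exprn_gt0 ?mulr_gt0//.
  apply: (le_trans (it _ _)).
  rewrite exprMn -exprM [leRHS](_ : _ = a 0%N ^+ (2 ^ k) * (K * th ^+ (m * 2 ^ k))).
    by apply: ler_wpM2l; [exact/exprn_ge0/ltW | exact: bd].
  by ring.
(* For this [k], the Bernoulli bound 1 + 2^(k+1) (rho - 1) already exceeds K / a 0. *)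
pose k := Num.truncn (K / a 0%N / (rho - 1)).
have := bnd k.+1; apply/negP; rewrite -ltNge.
have rho10 : 0 < rho - 1 by rewrite subr_gt0.
have big j : 1 + j%:R * (rho - 1) <= rho ^+ j.
  have rho1N : -1 <= rho - 1 by rewrite (le_trans _ (ltW rho10))// lerN10.
  by have := bernoulli_ineq j rho1N; rewrite [1 + (rho - 1)]addrC subrK.
apply: lt_le_trans (big _).
have : k.+1%:R * (rho - 1) <= (2 ^ k.+1)%:R * (rho - 1).
  by rewrite ler_wpM2r ?(ltW rho10)// ler_nat ltnW// ltn_expl.
have := truncnS_gt (K / a 0%N / (rho - 1)); rewrite -/k ltr_pdivrMr//.
by move=> /lt_le_trans /[apply] /lt_trans; apply; rewrite ltrDr.
Qed.

(** Splitting off the parities of j and k leaves a square times one of 1, th - X, th + X, th^2 -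
    X^2. The linear factors use the previous bound with m = 1, the quadratic one uses m = 2. *)
Lemma momf_endpoints_ge0 j k :
  0 <= momf g ((th%:P - 'X) ^+ j * (th%:P + 'X) ^+ k).
Proof.
have base q (e f : bool) :
    0 <= momf g ((th%:P - 'X) ^+ e * (th%:P + 'X) ^+ f * q ^+ 2).
  have b1 := momfXM_le 1 q; have b2 := momfXM_le 2 q.
  have le1 : - (th * momf g (q ^+ 2)) <= momf g ('X * q ^+ 2)
      <= th * momf g (q ^+ 2) by rewrite -ler_norml -{1}['X]expr1.
  have le2 : momf g ('X^2 * q ^+ 2) <= th ^+ 2 * momf g (q ^+ 2).
    exact: le_trans (ler_norm _) b2.
  case: e; case: f; rewrite ?expr0 ?expr1 ?mul1r ?mulr1.
  - rewrite (_ : _ * _ = th ^+ 2 *: q ^+ 2 - 'X^2 * q ^+ 2).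
      by rewrite linearB linearZ /= subr_ge0.
    by rewrite -mul_polyC rmorphXn /=; ring.
  - rewrite mulrBl mul_polyC linearB linearZ /= subr_ge0.
    by case/andP: le1.
  - rewrite mulrDl mul_polyC linearD linearZ /= addrC -lerBlDr sub0r.
    by case/andP: le1.
  - exact: gpos.
have := base ((th%:P - 'X) ^+ j./2 * (th%:P + 'X) ^+ k./2) (odd j) (odd k).
rewrite exprMn -!exprM !muln2 mulrACA -!exprD.
by rewrite !odd_double_half.
Qed.

End Positive.
End MomentFunctional.

(** * Conditional positive definiteness *)

Section CondPosDef.
Variable R : realType.
Implicit Types (g : R ^nat) (p q : {poly R}).

Definition diff2 g : R ^nat := fun n => g n.+2 - 2 * g n.+1 + g n.

Lemma momf_diff2 g p : momf (diff2 g) p = momf g (('X - 1) ^+ 2 * p).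
Proof.
have L q : momf g (('X - 1) ^+ 2 * q) =
    momf g ('X^2 * q) - 2 * momf g ('X * q) + momf g q.
  rewrite (_ : ('X - 1) ^+ 2 * q = 'X^2 * q - (2 : R) *: ('X * q) + q).
    by rewrite linearD linearB linearZ.
  by rewrite -mul_polyC (_ : (2 : R)%:P = 2) ?rmorph_nat//; ring.
rewrite L (momfXM g 2) (momfXM g 1) /momf mulr_sumr -sumrB -big_split /=.
by apply: eq_bigr => i _; rewrite /diff2 add2n add1n; ring.
Qed.

Lemma quad_form_momf g k (u : 'I_k.+1 -> R) :
  \sum_(i < k.+1) \sum_(j < k.+1) g (i + j)%N * (u i * u j) =
  momf g ((\sum_(i < k.+1) u i *: 'X^i) ^+ 2).
Proof.
rewrite expr2 mulr_suml linear_sum /=; apply: eq_bigr => i _.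
rewrite mulr_sumr linear_sum /=; apply: eq_bigr => j _.
by rewrite -[in RHS]scalerAl -[in RHS]scalerAr !linearZ /= -exprD momfXn mulrC mulrA.
Qed.

Local Open Scope complex_scope.

Lemma cond_pos_defP g :
  cond_pos_def g <-> forall q, 0 <= momf (diff2 g) (q ^+ 2).
Proof.
split=> [cpd q|pos k l l0].
  (* Taking n.+1 indices with n = (size p).-1 makes p = 0 fit the nonempty index type of the
     definition. *)
  pose p := ('X - 1) * q; pose n := (size p).-1.
  have pn : p = \sum_(i < n.+1) p`_i *: 'X^i.
    rewrite -poly_def; apply/polyP => i; rewrite coef_poly; case: ltnP => // ni.
    by rewrite nth_default// (leq_trans (leqSpred _)).
  rewrite momf_diff2 -exprMn -/p pn -quad_form_momf.
  have := cpd n (fun i => (p`_i)%:C).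
  have -> : \sum_(i < n.+1) (p`_i)%:C = 0.
    have p1 : p.[1] = 0 by rewrite !hornerE subrr mul0r.
    rewrite -rmorph_sum /= (_ : \sum_(i < n.+1) p`_i = p.[1]); first by rewrite p1.
    rewrite [in RHS]pn horner_sum.
    by apply: eq_bigr => i _; rewrite !hornerE expr1n mulr1.
  move=> /(_ erefl).
  under eq_bigr do under eq_bigr do rewrite conjc_real -!rmorphM /= -mulrA.
  under eq_bigr do rewrite -rmorph_sum /=.
  by rewrite -rmorph_sum /= lecR.
pose u i := complex.Re (l i); pose v i := complex.Im (l i).
have wpos (w : 'I_k.+1 -> R) : \sum_i w i = 0 ->
    0 <= \sum_(i < k.+1) \sum_(j < k.+1) g (i + j)%N * (w i * w j).
  move=> w0; rewrite quad_form_momf.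
  have /factor_theorem [q ->] : root (\sum_(i < k.+1) w i *: 'X^i) 1.
    rewrite rootE horner_sum -[X in _ == X]w0; apply/eqP; apply: eq_bigr => i _.
    by rewrite !hornerE expr1n mulr1.
  by rewrite exprMn mulrC -momf_diff2.
have sumC (F : 'I_k.+1 -> R[i]) :
    \sum_i F i = (\sum_i complex.Re (F i)) +i* (\sum_i complex.Im (F i)).
  by rewrite -!raddf_sum; case: (\sum_i _).
have [u0 v0] : \sum_i u i = 0 /\ \sum_i v i = 0.
  by move: l0; rewrite sumC => /eqP; rewrite eq_complex => /andP[/eqP ? /eqP ?].
rewrite (_ : \sum_i _ = (\sum_(i < k.+1) \sum_(j < k.+1) g (i + j)%N * (u i * u j) +
    \sum_(i < k.+1) \sum_(j < k.+1) g (i + j)%N * (v i * v j))%:C).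
  by rewrite lecR addr_ge0 ?wpos.
rewrite sumC; congr (_ +i* _).
  rewrite -big_split /=; apply: eq_bigr => i _.
  rewrite -big_split /= raddf_sum; apply: eq_bigr => j _.
  by rewrite /u /v; case: (l i) => a b; case: (l j) => c d /=; ring.
under eq_bigr do rewrite raddf_sum /=.
(* The imaginary part is S minus its transpose, which is 0 because g (i + j) is symmetric in i and
   j. *)
pose S := \sum_(i < k.+1) \sum_(j < k.+1) g (i + j)%N * (v i * u j).
transitivity (S - S); last exact: subrr.
rewrite /S [X in _ - X]exchange_big /= -sumrB; apply: eq_bigr => i _.
rewrite -sumrB; apply: eq_bigr => j _.
rewrite [(j + i)%N]addnC /u /v.
by case: (l i) => a b; case: (l j) => c d /=; ring.
Qed.

End CondPosDef.

(** * Exponential growth *)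

Section Growth.
Variable R : realType.
Implicit Types (g : R ^nat).

Definition growth_rates g : set R := [set theta : R | 0 <= theta /\
  exists alpha : R, 0 <= alpha /\
    forall n : nat, `|g n| <= alpha * theta ^+ n].

Lemma powR_invn_le (a M : R) n : (0 < n)%N -> 0 <= a -> 0 <= M ->
  (a `^ n%:R^-1 <= M) = (a <= M ^+ n).
Proof.
move=> n0 a0 M0.
have aE : (a `^ n%:R^-1) ^+ n = a.
  by rewrite -powR_mulrn ?powR_ge0// -powRrM mulVf ?powRr1// pnatr_eq0 -lt0n.
by rewrite -[X in _ = (X <= _)]aE ler_pXn2r ?nnegrE ?powR_ge0.
Qed.

(** The finitely many exceptional terms, divided by M^i with M > 0, are absorbed into the
    constant. *)
Lemma growth_rates_eventually g M N : 0 < M ->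
  (forall n, (N <= n)%N -> `|g n| <= M ^+ n) -> growth_rates g M.
Proof.
move=> M0 gM; split; first exact: ltW.
pose S := \sum_(i < N) `|g i| / M ^+ i.
have S0 : 0 <= S by apply: sumr_ge0 => i _; rewrite divr_ge0// exprn_ge0// ltW.
exists (1 + S); split=> [|n]; first by rewrite addr_ge0.
rewrite mulrDl mul1r; case: (ltnP n N) => nN; last first.
  by rewrite (le_trans (gM _ nN))// lerDl mulr_ge0// exprn_ge0// ltW.
rewrite (@le_trans _ _ (S * M ^+ n))// ?lerDr ?exprn_ge0// ?(ltW M0)//.
rewrite -ler_pdivrMr ?exprn_gt0// /S (bigD1 (Ordinal nN))//= lerDl.
by apply: sumr_ge0 => i _; rewrite divr_ge0// exprn_ge0// ltW.
Qed.

(** A strictly larger rate absorbs the constant, since a (th / M)^n tends to 0. *)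
Lemma growth_rates_lt g th M : th < M -> growth_rates g th ->
  \forall n \near \oo, `|g n| <= M ^+ n.
Proof.
move=> thM [th0 [a [a0 ga]]].
have M0 : 0 < M by exact: le_lt_trans thM.
have : a * (th / M) ^+ n @[n --> \oo] --> a * 0.
  apply: cvgM; [exact: cvg_cst|apply: cvg_expr].
  by rewrite ger0_norm ?divr_ge0// ?(ltW M0)// ltr_pdivrMr// mul1r.
rewrite mulr0 => /cvgr0_norm_le /(_ 1 ltr01) [N _ aN].
exists N => // n /= /aN; rewrite /= ger0_norm; last first.
  by rewrite mulr_ge0// exprn_ge0// divr_ge0// ltW.
rewrite expr_div_n mulrA ler_pdivrMr ?exprn_gt0// mul1r.
exact: le_trans (ga n).
Qed.

(** Each inequality is proved up to an arbitrary e > 0. In one direction e absorbs the constant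
    alpha; in the other it keeps the rate M + e positive even when the supremum M of the roots is
    0. *)
Lemma limsup_rootE g : limsup_root g = ereal_inf [set x%:E | x in growth_rates g].
Proof.
pose u n := (`|g n| `^ n%:R^-1)%:E.
apply/eqP; rewrite eq_le; apply/andP; split.
  apply/ereal_infP => _ [th [th0 gth] <-].
  apply/lee_addgt0Pr => e e0; rewrite -EFinD.
  have [N _ gN] : \forall n \near \oo, `|g n| <= (th + e) ^+ n.
    by apply: (@growth_rates_lt _ th); rewrite ?ltrDl.
  (* Starting the tail at [N.+1] skips the index 0, where the root is 1 by convention. *)
  apply: (@le_trans _ _ (ereal_sup (u @` [set n | (N.+1 <= n)%N]))).
    by apply: ereal_inf_lbound; exists [set n | (N.+1 <= n)%N] => //; exists N.+1.
  apply/ereal_supP => _ [n Nn <-]; rewrite /u lee_fin powR_invn_le//.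
  - by apply: gN; exact: ltnW.
  - exact: leq_ltn_trans Nn.
  - by rewrite addr_ge0// ltW.
apply/ereal_infP => _ [V [N _ NV] <-].
have sup_ge n : (N <= n)%N -> (u n <= ereal_sup (u @` V))%E.
  by move=> Nn; apply: ereal_sup_ubound; exists n => //; exact: NV.
rewrite -/u.
move: sup_ge; case: (ereal_sup _) => [M||] sup_ge; last 2 first.
- exact: leey.
- by have := sup_ge N (leqnn _); rewrite leNgt ltNyr.
have M0 : 0 <= M.
  by have := sup_ge N (leqnn _); rewrite lee_fin; apply: le_trans; exact: powR_ge0.
apply/lee_addgt0Pr => e e0; rewrite -EFinD; apply: ereal_inf_lbound.
exists (M + e) => //; apply: (@growth_rates_eventually _ _ N.+1).
  by rewrite ltr_wpDl.
move=> n Nn; rewrite (@le_trans _ _ (M ^+ n))//; last first.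
  by rewrite lerXn2r ?nnegrE ?addr_ge0 ?(ltW e0)// lerDl ltW.
rewrite -powR_invn_le ?(leq_ltn_trans _ Nn)// -lee_fin; apply: sup_ge.
exact: ltnW.
Qed.

Lemma limsup_root_ltP g (x : R) : (limsup_root g < x%:E)%E ->
  exists2 th, growth_rates g th & th < x.
Proof.
by rewrite limsup_rootE => /ereal_inf_lt [_ [th gth <-]]; rewrite lte_fin; exists th.
Qed.

Lemma limsup_root_le g th : growth_rates g th -> (limsup_root g <= th%:E)%E.
Proof. by rewrite limsup_rootE => gth; apply: ereal_inf_lbound; exists th. Qed.

Lemma limsup_root_lty g :
  (limsup_root g < +oo)%E <-> exists th, growth_rates g th.
Proof.
split=> [|[th gth]]; last by rewrite (le_lt_trans (limsup_root_le gth)) ?ltry.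
by rewrite limsup_rootE => /ereal_inf_lt [_ [th gth _] _]; exists th.
Qed.

(** The constant D = C / (th - 1) solves C + D = th D, which closes the induction. The conclusion
    can fail for th <= 1: constant sequences for th < 1, linear ones for th = 1. *)
Lemma growth_rates_delta g th : 1 < th ->
  growth_rates (fun n => g n.+1 - g n) th -> growth_rates g th.
Proof.
move=> th1 [th0 [C [C0 gC]]]; split=> //.
have th10 : 0 < th - 1 by rewrite subr_gt0.
exists (`|g 0%N| + C / (th - 1)); split.
  by rewrite addr_ge0// divr_ge0// ltW.
elim=> [|n IH]; first by rewrite expr0 mulr1 lerDl divr_ge0// ltW.
rewrite -(subrK (g n) (g n.+1)) (le_trans (ler_normD _ _))//.
apply: le_trans (lerD (gC n) IH) _.
rewrite -mulrDl exprS mulrA ler_wpM2r ?exprn_ge0//.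
have := divfK (lt0r_neq0 th10) C; set D := C / _ => DE.
have : 0 <= D by rewrite divr_ge0// ltW.
have := normr_ge0 (g 0%N); nra.
Qed.

Lemma growth_rates_diff2 g th : 0 <= th -> growth_rates g th ->
  growth_rates (diff2 g) th.
Proof.
move=> th0 [_ [a [a0 ga]]]; split=> //.
exists (a * (th ^+ 2 + 2 * th + 1)); split.
  by rewrite mulr_ge0// !addr_ge0 ?exprn_ge0// mulr_ge0.
move=> n; rewrite /diff2.
apply: (@le_trans _ _ (`|g n.+2| + 2 * `|g n.+1| + `|g n|)).
  rewrite (le_trans (ler_normD _ _))// lerD2r (le_trans (ler_normB _ _))//.
  by rewrite lerD2l normrM ger0_norm.
have := ga n; have := ga n.+1; have := ga n.+2; rewrite !exprS.
set x := th ^+ n; lra.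
Qed.

Lemma diff2_growth_rates g th : 1 < th -> growth_rates (diff2 g) th ->
  growth_rates g th.
Proof.
move=> th1 [th0 [C [C0 gC]]]; do 2 apply: growth_rates_delta => //.
split=> //; exists C; split=> // n; apply: le_trans (gC n).
by rewrite /diff2 le_eqVlt; apply/orP; left; apply/eqP; congr `|_|; ring.
Qed.

End Growth.

(** * Finite measures with bounded support *)

Section BoundedSupport.
Variable R : realType.
Implicit Types (mu : borel_finite_measure R) (p : {poly R}).

(** Stated as a null set rather than through the support, which is the form that integration uses;
    [msupport_bounded_by] and [bounded_by_msupport] translate between the two. *)
Definition bounded_by mu (r : R) := mu (~` `[(- r), r]%classic) = 0%E.

Lemma measurable_itvR (i : interval R) :
  measurable ([set` i] : set (measurableTypeR R)).
Proof. exact: measurable_itv. Qed.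

Lemma measurable_itvC (i : interval R) :
  measurable (~` [set` i] : set (measurableTypeR R)).
Proof. by apply: measurableC; exact: measurable_itv. Qed.

Lemma bounded_byW mu r s : r <= s -> bounded_by mu r -> bounded_by mu s.
Proof.
move=> rs; apply: (subset_measure0 (measurable_itvC _) (measurable_itvC _)).
apply: subsetC => x /=; rewrite !in_itv /= => /andP[rx xr].
by rewrite (le_trans _ rx) ?lerN2//= (le_trans xr).
Qed.

(** A Lindelof argument: each point off the support lies in a null open interval with rational
    endpoints, and there are countably many of these. *)
Lemma msupport_bounded_by mu r :
  msupport mu `<=` `[(- r), r]%classic -> bounded_by mu r.
Proof.
move=> sub.
(* [J] enumerates the null rational intervals; all other indices give the empty set. *)
pose J (n : nat) : set (measurableTypeR R) :=
  if unpickle n is Some (a, b) then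
    if mu `](ratr a : R), ratr b[%classic == 0%E then `](ratr a : R), ratr b[%classic
    else set0
  else set0.
have J0 n : mu.-negligible (J n).
  rewrite /J; case: unpickle => [[a b]|]; last exact: negligible_set0.
  case: eqP => [ab0|_]; last exact: negligible_set0.
  by exists `](ratr a : R), ratr b[%classic; split => //; exact: measurable_itv.
apply/(negligibleP _ (measurable_itvC _)).
apply: negligibleS (negligible_bigcup J0) => x /= xr.
have [U oU [Ux U0]] : exists2 U : set R, open U & U x /\ mu U = 0%E.
  apply: contrapT => h; apply: xr; apply: sub => U oU Ux.
  rewrite lt0e measure_ge0 andbT; apply/negP => /eqP U0; apply: h.
  by exists U.
have := open_nbhs_nbhs (conj oU Ux) => /nbhs_ballP [e /= e0 eU].
have [a] := @rat_in_itvoo R (x - e) x (ltac:(by rewrite ltrBlDr ltrDl)).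
have [b] := @rat_in_itvoo R x (x + e) (ltac:(by rewrite ltrDl)).
rewrite !in_itv /= => /andP[xb be] /andP[ea ax].
exists (pickle (a, b)); first exact: Logic.I.
rewrite /J pickleK.
have -> : mu `](ratr a : R), ratr b[%classic = 0%E.
  have mU : measurable (U : set (measurableTypeR R)).
    exact: open_measurable.
  apply: (subset_measure0 (measurable_itvR _) mU _ U0) => y /=.
  rewrite in_itv /= => /andP[ay yb]; apply: eU; rewrite /ball /= ltr_norml.
  by apply/andP; split; lra.
by rewrite eqxx /= in_itv /= ax.
Qed.

Lemma compact_msupport_bounded mu : compact (msupport mu) ->
  exists2 r, 0 <= r & msupport mu `<=` `[(- r), r]%classic.
Proof.
move=> /compact_bounded [r [_ rM]]; exists (`|r| + 1); first by rewrite addr_ge0.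
move=> x /(rM (`|r| + 1)) /=; rewrite in_itv /= -ler_norml; apply.
by rewrite (le_lt_trans (ler_norm r))// ltrDl.
Qed.

Lemma closed_msupport mu : closed (msupport mu).
Proof.
rewrite -[X in closed X]setCK; apply: open_closedC.
rewrite openE => x /= nx.
have [U oU [Ux U0]] : exists2 U : set R, open U & U x /\ ~ (0 < mu U)%E.
  by apply: contrapT => h; apply: nx => U oU Ux; apply: contrapT => ?; apply: h; exists U.
rewrite /interior; apply: filterS (open_nbhs_nbhs (conj oU Ux)).
by move=> y Uy /(_ U oU Uy).
Qed.

Lemma bounded_by_msupport mu r :
  bounded_by mu r -> msupport mu `<=` `[(- r), r]%classic.
Proof.
move=> mur x xs; apply: contrapT => nx.
have := xs (~` `[(- r), r]%classic); rewrite (_ : mu _ = 0%E)// => /(_ _ nx).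
rewrite ltxx => h; suff : false by []. apply: h.
exact/closed_openC/itv_closed.
Qed.

Lemma bounded_by_compact mu r : bounded_by mu r -> compact (msupport mu).
Proof.
move=> mur; apply: (subclosed_compact (@closed_msupport mu) (@segment_compact _ (- r) r)).
exact: bounded_by_msupport.
Qed.

Lemma measurable_horner p :
  measurable_fun [set: measurableTypeR R] (fun x : R => p.[x]).
Proof.
by apply: (@continuous_measurable_fun R); exact: continuous_horner.
Qed.

Lemma horner_le_itv r p x : x \in `[(- r), r] ->
  `|p.[x]| <= \sum_(i < size p) `|p`_i| * r ^+ i.
Proof.
rewrite in_itv /= -ler_norml => xr; rewrite horner_coef.
rewrite (le_trans (ler_norm_sum _ _ _))//; apply: ler_sum => i _.
by rewrite normrM normrX ler_wpM2l// lerXn2r ?nnegrE// (le_trans _ xr).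
Qed.

Lemma norm_Rintegral_le mu (A : set (measurableTypeR R)) (f : measurableTypeR R -> R) c :
  measurable A -> mu (~` A) = 0%E -> mu.-integrable setT (EFin \o f) ->
  0 <= c -> (forall x, A x -> `|f x| <= c) -> `|\int[mu]_x f x| <= c * fine (mu setT).
Proof.
move=> mA muA intf c0 fc.
have -> : \int[mu]_x f x = \int[mu]_(x in A) f x.
  congr fine; rewrite (negligible_integral (measurableC mA) measurableT intf muA).
  by rewrite setTD setCK.
have intfA : mu.-integrable A (EFin \o f) by exact: (integrableS measurableT).
rewrite (le_trans (le_normr_Rintegral mA intfA))//.
apply: (@le_trans _ _ (\int[mu]_(x in A) c)).
  apply: le_Rintegral => //; first exact: integrable_norm.
  exact: finite_measure_integrable_cst.
rewrite Rintegral_cst// ler_wpM2l//.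
by rewrite fine_le ?fin_num_measure// le_measure ?inE.
Qed.

Section FixedMeasure.
Variables (mu : borel_finite_measure R) (r : R).
Hypothesis mur : bounded_by mu r.

Lemma integrable_horner p :
  mu.-integrable setT (EFin \o (fun x : measurableTypeR R => p.[x : R])).
Proof.
apply/(negligible_integrable (measurable_itvC `[(- r), r]) measurableT _ mur).
  by apply/measurable_EFinP; exact: measurable_horner.
rewrite setTD setCK.
apply: measurable_bounded_integrable.
- exact: measurable_itv.
- by rewrite -ge0_fin_numE// fin_num_measure//; exact: measurable_itv.
- by apply: measurable_funTS; exact: measurable_horner.
- exists (\sum_(i < size p) `|p`_i| * r ^+ i); split; first exact: num_real.
  by move=> M /ltW SM x xr; apply: le_trans SM; exact: horner_le_itv.
Qed.

Definition moment (m : borel_finite_measure R) (n : nat) : R := \int[m]_x (x : R) ^+ n.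

Lemma Rintegral_horner p : \int[mu]_x p.[x : R] = momf (moment mu) p.
Proof.
rewrite -{1}(coefK p) poly_def /momf.
elim: (size p) => [|n IH].
  rewrite !big_ord0 -[RHS](mul0r (fine (mu setT))) -Rintegral_cst//.
  by apply: eq_Rintegral => x _; rewrite horner0.
rewrite !big_ord_recr /= -IH /moment -RintegralZl//; last first.
  have := integrable_horner 'X^n; congr (_.-integrable _ _).
  by apply/funext => x /=; rewrite hornerXn.
rewrite -RintegralD//.
- by apply: eq_Rintegral => x _; rewrite hornerD hornerZ hornerXn.
- exact: integrable_horner.
- have := integrable_horner (p`_n *: 'X^n); congr (_.-integrable _ _).
  by apply/funext => x /=; rewrite hornerZ hornerXn.
Qed.

Lemma momf_moment_sqr_ge0 p : 0 <= momf (moment mu) (p ^+ 2).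
Proof.
by rewrite -Rintegral_horner; apply: Rintegral_ge0 => x _; rewrite horner_exp sqr_ge0.
Qed.

Lemma moment_le n : 0 <= r -> `|moment mu n| <= r ^+ n * fine (mu setT).
Proof.
move=> r0; apply: (norm_Rintegral_le (measurable_itvR `[(- r), r]) mur).
- have := integrable_horner 'X^n; congr (_.-integrable _ _).
  by apply/funext => x /=; rewrite hornerXn.
- exact: exprn_ge0.
- move=> x /=; rewrite in_itv /= -ler_norml => xr.
  by rewrite normrX lerXn2r ?nnegrE.
Qed.

(** Markov's inequality; the even exponent makes the integrand nonnegative on both sides of 0. *)
Lemma moment_ge n (t : R) : 0 <= t ->
  t ^+ (2 * n) * fine (mu (~` `[(- t), t]%classic)) <= moment mu (2 * n).
Proof.
move=> t0; pose A : set (measurableTypeR R) := ~` `[(- t), t]%classic.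
have mA : measurable A by exact: measurable_itvC.
have iA : mu.-integrable setT (EFin \o (\1_A : measurableTypeR R -> R)).
  exact: integrable_indic.
have -> : fine (mu A) = \int[mu]_x (\1_A x).
  by rewrite /Rintegral integral_indic// setIT.
rewrite -RintegralZl// /moment; apply: le_Rintegral => //.
- have := finite_measure_integrable_cst mu (t ^+ (2 * n)) mA.
  move/(integrable_mkcond _ mA); congr (_.-integrable _ _).
  apply/funext => x; rewrite /patch /= indicE; case: ifP => _; first by rewrite mulr1.
  by rewrite mulr0.
- have := integrable_horner 'X^(2 * n); congr (_.-integrable _ _).
  by apply/funext => x /=; rewrite hornerXn.
- move=> x _; rewrite indicE; case: (boolP (x \in A)) => [|_] /=; last first.
    by rewrite mulr0 exprM exprn_ge0// sqr_ge0.
  rewrite inE /A /= in_itv /= -ler_norml => /negP; rewrite -ltNge => /ltW tx.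
  rewrite mulr1 !exprM -[x ^+ 2]real_normK ?num_real//.
  by rewrite lerXn2r ?nnegrE ?sqr_ge0// lerXn2r ?nnegrE.
Qed.

End FixedMeasure.

End BoundedSupport.

(** * Bernstein weights and step functions *)

Section StepFunctions.
Variable R : realType.

(** The ratio is the product of the factors (k - i) / (n - i) for i < m, each within M / (n - M) of
    k / n. The auxiliary M keeps this error fixed while m varies in the induction. *)
Lemma binomial_ratio_approx (m M n k : nat) : (m <= M)%N -> (M < n)%N -> (k <= n)%N ->
  `|'C(k, m)%:R / 'C(n, m)%:R - (k%:R / n%:R) ^+ m| <= m%:R * (M%:R / (n - M)%:R) :> R.
Proof.
move=> + Mn kn.
have n0 : 0 < n%:R :> R by rewrite ltr0n (leq_ltn_trans _ Mn).
have x0 : 0 <= k%:R / n%:R :> R by rewrite divr_ge0.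
have x1 : k%:R / n%:R <= 1 :> R by rewrite ler_pdivrMr// mul1r ler_nat.
elim: m => [|m IH] mM; first by rewrite !bin0 divr1 expr0 subrr normr0 mul0r.
have mn : (m < n)%N by exact: ltn_trans Mn.
have nm0 : 0 < (n - m)%:R :> R by rewrite ltr0n subn_gt0.
have nM0 : 0 < (n - M)%:R :> R by rewrite ltr0n subn_gt0.
have rec j : m.+1%:R * 'C(j, m.+1)%:R = (j - m)%:R * 'C(j, m)%:R :> R.
  by rewrite -!natrM mul_bin_left.
have Cn0 : 0 < 'C(n, m)%:R :> R by rewrite ltr0n bin_gt0 ltnW.
have Cn1 : 0 < 'C(n, m.+1)%:R :> R by rewrite ltr0n bin_gt0.
set x := k%:R / n%:R in x0 x1 IH *.
pose y : R := (k - m)%:R / (n - m)%:R.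
have -> : 'C(k, m.+1)%:R / 'C(n, m.+1)%:R = 'C(k, m)%:R / 'C(n, m)%:R * y.
  apply: (@mulfI _ m.+1%:R); first by rewrite pnatr_eq0.
  rewrite mulrA rec /y.
  have -> : 'C(n, m.+1)%:R = (n - m)%:R * 'C(n, m)%:R / m.+1%:R :> R.
    by rewrite -rec mulrAC divff ?mul1r ?pnatr_eq0.
  by field; rewrite !lt0r_neq0//= pnatr_eq0.
have y0 : 0 <= y by rewrite divr_ge0.
have y1 : y <= 1 by rewrite ler_pdivrMr// mul1r ler_nat leq_sub2r.
have Mle : m%:R / (n - m)%:R <= M%:R / (n - M)%:R :> R.
  rewrite ler_pM ?invr_ge0// ?ler_nat ?(ltnW mM)//.
  by rewrite lef_pV2 ?posrE// ler_nat leq_sub2l// ltnW.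
have yx : `|y - x| <= M%:R / (n - M)%:R.
  apply: le_trans Mle; rewrite distrC ger0_norm; last first.
    rewrite subr_ge0 /y /x; case: (leqP k m) => km.
      by rewrite (eqP (_ : k - m == 0)%N) ?subn_eq0// mul0r.
    rewrite ler_pdivrMr// mulrAC ler_pdivlMr// -!natrM ler_nat.
    rewrite mulnBl mulnBr leq_sub2l// [(m * n)%N]mulnC leq_mul2r kn orbT//.
  rewrite lerBlDr /y -mulrDl (@le_trans _ _ (k%:R / (n - m)%:R))//.
    by rewrite ler_wpM2l// lef_pV2 ?posrE// ler_nat leq_subr.
  by rewrite ler_wpM2r ?invr_ge0// -natrD ler_nat -leq_subLR.
rewrite exprSr (_ : _ - _ = ('C(k, m)%:R / 'C(n, m)%:R - x ^+ m) * y + x ^+ m * (y - x)).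
  rewrite (le_trans (ler_normD _ _))// -[m.+1%:R]natr1 [leRHS]mulrDl mul1r lerD//.
    rewrite normrM (ger0_norm y0) (le_trans _ (IH (ltnW mM)))//.
    by rewrite ler_piMr.
  rewrite normrM ger0_norm ?exprn_ge0// (le_trans _ yx)// ler_piMl//.
  by rewrite exprn_ile1.
by ring.
Qed.

(** Both sides are the trinomial coefficient n! / (m! i! (n - m - i)!). *)
Lemma bin_trinomial (m i n : nat) : (m + i <= n)%N ->
  ('C(n, m) * 'C(n - m, i) = 'C(n, m + i) * 'C(m + i, m))%N.
Proof.
move=> min; have mn := leq_trans (leq_addr _ _) min.
have h1 := bin_fact mn; have h2 := bin_fact min.
have h3 : ('C(n - m, i) * (i`! * (n - (m + i))`!))%N = (n - m)`!.
  by rewrite subnDA bin_fact// leq_subRL.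
have h4 : ('C(m + i, m) * (m`! * i`!))%N = (m + i)`!.
  by have := bin_fact (leq_addr i m); rewrite addKn.
apply/eqP; rewrite -(@eqn_pmul2r (m`! * (i`! * (n - (m + i))`!))) ?muln_gt0 ?fact_gt0//.
rewrite mulnACA h3 -mulnA h1 [(m`! * (i`! * _))%N]mulnA -mulnA.
by rewrite [('C(m + i, m) * (_ * _))%N]mulnA h4 h2.
Qed.

Lemma expr_lipschitz m (s t : R) : 0 <= s <= 1 -> 0 <= t <= 1 ->
  `|s ^+ m - t ^+ m| <= m%:R * `|s - t|.
Proof.
move=> /andP[s0 s1] /andP[t0 t1].
elim: m => [|m IH]; first by rewrite !expr0 subrr normr0 mul0r.
rewrite (_ : _ - _ = s * (s ^+ m - t ^+ m) + t ^+ m * (s - t)); last first.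
  by rewrite !exprS; ring.
rewrite (le_trans (ler_normD _ _))// -[m.+1%:R]natr1 [leRHS]mulrDl mul1r lerD// normrM.
  by rewrite (le_trans _ IH)// ger0_norm// ler_piMl.
by rewrite ler_piMl// ger0_norm ?exprn_ge0// exprn_ile1.
Qed.

(** A left Riemann sum for 1 - \int_0^1 F(y) d(y^m), which by parts is the m-th moment of a
    distribution function F carried by [0, 1]. *)
Definition step_sum (N m : nat) (F : R -> R) : R :=
  1 - \sum_(i < N) ((i.+1%:R / N%:R) ^+ m - (i%:R / N%:R) ^+ m) * F (i%:R / N%:R).

(* By Abel summation this is [(j / N) ^+ m] where [j / N] is the first node not
   below [t]. *)
Definition step_pow (N m : nat) (t : R) : R :=
  step_sum N m (fun y => (t <= y)%R%:R).

Lemma step_pow_approx N m t : 0 <= t <= 1 ->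
  `|t ^+ m - step_pow N.+1 m t| <= m%:R / N.+1%:R.
Proof.
move=> t01; pose x (i : nat) : R := i%:R / N.+1%:R.
(* [S k] follows x k ^ m up to the first node not below t and is constant from there on. *)
pose S k := x k ^+ m - \sum_(i < k) (x i.+1 ^+ m - x i ^+ m) * (t <= x i)%R%:R.
have xS k : x k.+1 = x k + N.+1%:R^-1 by rewrite /x -natr1 mulrDl mul1r.
have i0 : 0 < N.+1%:R^-1 :> R by rewrite invr_gt0.
have x01 k : (k <= N.+1)%N -> 0 <= x k <= 1.
  by move=> kN; rewrite divr_ge0//= ler_pdivrMr// mul1r ler_nat.
suff H k : (k <= N.+1)%N ->
    (x k < t -> S k = x k ^+ m) /\ (t <= x k -> `|t ^+ m - S k| <= m%:R / N.+1%:R).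
  have xN : x N.+1 = 1 by rewrite /x divff ?pnatr_eq0.
  have := H N.+1 (leqnn _); rewrite /S xN expr1n.
  by case=> _; apply; case/andP: t01.
elim: k => [|k IH] kN.
  rewrite /S big_ord0 subr0; split=> //; rewrite /x mul0r => t0.
  have -> : t = 0 by apply/eqP; rewrite eq_le t0; case/andP: t01.
  by rewrite subrr normr0 divr_ge0.
have [IH1 IH2] := IH (ltnW kN).
have SS : S k.+1 = S k + (x k.+1 ^+ m - x k ^+ m) * (1 - (t <= x k)%R%:R).
  by rewrite /S big_ord_recr /=; ring.
have xk : x k < x k.+1 by rewrite xS ltrDl.
rewrite SS; split=> [xt|tx].
  have xt' := lt_trans xk xt; rewrite IH1// leNgt xt' /=; ring.
case: (leP t (x k)) => tk; first by rewrite /= subrr mulr0 addr0; exact: IH2.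
rewrite IH1//= subr0 mulr1 [X in _ - X]addrC subrK.
rewrite (le_trans (expr_lipschitz m t01 (x01 _ kN)))// ler_wpM2l//.
by rewrite distrC ger0_norm ?subr_ge0// lerBlDr addrC xS lerD2r ltW.
Qed.

(** The gap F - G at a node is at most the increment of G to the next node, and these increments
    telescope. No continuity of G enters, so F can be the function of right limits of G. *)
Lemma step_sum_dist N m (F G : R -> R) :
  (forall x, G x <= F x) -> (forall x y, x < y -> F x <= G y) ->
  `|step_sum N.+1 m F - step_sum N.+1 m G| <= m%:R / N.+1%:R * (G 1 - G 0).
Proof.
move=> GF FG; pose x (i : nat) : R := i%:R / N.+1%:R.
have x01 k : (k <= N.+1)%N -> 0 <= x k <= 1.
  by move=> kN; rewrite divr_ge0//= ler_pdivrMr// mul1r ler_nat.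
have xS k : x k < x k.+1 by rewrite ltr_pM2r ?invr_gt0// ltr_nat.
have -> : step_sum N.+1 m F - step_sum N.+1 m G =
    \sum_(i < N.+1) (x i.+1 ^+ m - x i ^+ m) * (G (x i) - F (x i)).
  by under eq_bigr do rewrite mulrBr; rewrite sumrB /step_sum; ring.
rewrite (le_trans (ler_norm_sum _ _ _))//.
apply: (@le_trans _ _ (\sum_(i < N.+1) m%:R / N.+1%:R * (G (x i.+1) - G (x i)))).
  apply: ler_sum => i _; rewrite normrM; apply: ler_pM => //.
    rewrite (le_trans (expr_lipschitz _ (x01 _ _) (x01 _ _)))// 1?ltnW//.
    rewrite ler_wpM2l// ger0_norm ?subr_ge0 ?(ltW (xS _))//.
    by rewrite /x -mulrBl -natr1 addrAC subrr add0r mul1r.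
  by rewrite distrC ger0_norm ?subr_ge0 ?GF// lerD2r FG.
rewrite -mulr_sumr -(big_mkord xpredT (fun i => G (x i.+1) - G (x i))).
by rewrite telescope_sumr// /x divff ?pnatr_eq0// mul0r.
Qed.

Lemma eq0_le_inv (a c : R) : (forall n : nat, `|a| <= c / n.+1%:R) -> a = 0.
Proof.
move=> h; apply/eqP; rewrite -normr_le0 leNgt; apply/negP => a0.
have := h (Num.truncn (c / `|a|)); rewrite ler_pdivlMr// mulrC -ler_pdivlMr//.
by rewrite leNgt truncnS_gt.
Qed.

End StepFunctions.

(** * Bernstein weights as discrete probability measures *)

Section BernsteinWeights.
Variables (R : realType) (g : R ^nat).
Hypothesis g0 : g 0%N = 1.
Hypothesis gpos : forall j k, 0 <= momf g ('X^j * (1 - 'X) ^+ k).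

(** The mass to be placed at the node k / n. *)
Definition bern_weight (n k : nat) : R :=
  'C(n, k)%:R * momf g ('X^k * (1 - 'X) ^+ (n - k)).

Let w := bern_weight.

Lemma bern_weight_ge0 n k : 0 <= w n k.
Proof. by rewrite mulr_ge0. Qed.

(** Obtained by expanding X^m (X + (1 - X))^(n - m). Binomial moments of the weights are thus exact,
    and only the passage to ordinary powers needs a limit. *)
Lemma bern_weight_moment m n : (m <= n)%N ->
  g m = \sum_(k < n.+1) 'C(k, m)%:R / 'C(n, m)%:R * w n k.
Proof.
move=> mn.
rewrite -(big_mkord xpredT (fun k => 'C(k, m)%:R / 'C(n, m)%:R * w n k)).
rewrite (@big_cat_nat _ _ _ m) ?(leq_trans mn)//=.
rewrite [X in _ = X + _]big_nat_cond big1 ?add0r => [|k]; last first.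
  by rewrite andbT => /andP[_ km]; rewrite bin_small// !mul0r.
rewrite -{2}[m]add0n big_addn subSn// big_mkord -momfXn.
rewrite -['X^m]mulr1 -[X in _ * X](expr1n _ (n - m)).
rewrite -[X in _ * X ^+ _](subrK ('X : {poly R})) exprDn mulr_sumr linear_sum /=.
apply: eq_bigr => i _; rewrite mulrnAr linearMn /= /w /bern_weight.
have im : (i <= n - m)%N by rewrite -ltnS.
have imn : (m + i <= n)%N by rewrite -leq_subRL.
rewrite -[LHS]mulr_natl [RHS]mulrA [(i + m)%N]addnC.
have -> : 'X^m * ((1 - 'X) ^+ (n - m - i) * 'X^i) =
    'X^(m + i) * (1 - 'X) ^+ (n - (m + i)) :> {poly R}.
  by rewrite subnDA exprD -mulrA; congr (_ * _); rewrite mulrC.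
congr (_ * _); have C0 : 'C(n, m)%:R != 0 :> R by rewrite pnatr_eq0 -lt0n bin_gt0.
apply: (mulfI C0); rewrite -natrM bin_trinomial// natrM; by field.
Qed.

Lemma sum_bern_weight n : \sum_(k < n.+1) w n k = 1.
Proof.
rewrite -g0 (bern_weight_moment (leq0n n)); apply: eq_bigr => k _.
by rewrite !bin0 divr1 mul1r.
Qed.

Definition bern_cdf n (y : R) := \sum_(k < n.+1) w n k * (k%:R / n%:R <= y)%R%:R.

Lemma bern_cdf_homo n : {homo bern_cdf n : x y / x <= y}.
Proof.
move=> x y xy; apply: ler_sum => k _; rewrite ler_wpM2l ?bern_weight_ge0// ler_nat.
by case: (leP (k%:R / n%:R) x) => // kx; rewrite (le_trans kx).
Qed.

Lemma bern_cdf_lt0 n y : y < 0 -> bern_cdf n y = 0.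
Proof.
move=> y0; rewrite /bern_cdf big1// => k _.
by rewrite leNgt (lt_le_trans y0) ?divr_ge0// mulr0.
Qed.

Lemma bern_node_le1 n (k : 'I_n.+1) : k%:R / n%:R <= 1 :> R.
Proof.
case: n k => [|n] k; first by rewrite invr0 mulr0.
by rewrite ler_pdivrMr// mul1r ler_nat -ltnS.
Qed.

Lemma bern_cdf_ge1 n y : 1 <= y -> bern_cdf n y = 1.
Proof.
move=> y1; rewrite -(sum_bern_weight n); apply: eq_bigr => k _.
by rewrite (le_trans (bern_node_le1 k) y1) mulr1.
Qed.

Lemma bern_cdf_itv n y : bern_cdf n y \in `[0, 1].
Proof.
rewrite in_itv /=; apply/andP; split.
  by apply: sumr_ge0 => k _; rewrite mulr_ge0// bern_weight_ge0.
rewrite -(sum_bern_weight n); apply: ler_sum => k _.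
by rewrite ler_piMr ?bern_weight_ge0// lern1 leq_b1.
Qed.

Lemma bern_moment_cvg m :
  \sum_(k < n.+1) w n k * (k%:R / n%:R) ^+ m @[n --> \oo] --> g m.
Proof.
apply/cvgrPdist_le => e e0.
(* The error m * m / (n - m) of [binomial_ratio_approx] is at most e once n - m exceeds m * m /
   e. *)
exists (m.+1 + (Num.truncn ((m * m)%:R / e)).+1)%N => // n /= mn.
have mn' : (m < n)%N by apply: leq_trans mn; rewrite leq_addr.
rewrite (bern_weight_moment (ltnW mn')) -sumrB (le_trans (ler_norm_sum _ _ _))//.
have nm0 : 0 < (n - m)%:R :> R by rewrite ltr0n subn_gt0.
rewrite -[leRHS]mulr1 -[X in _ <= e * X](sum_bern_weight n) mulr_sumr; apply: ler_sum => k _.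
rewrite [w n k * _]mulrC -mulrBl normrM [`|w n k|]ger0_norm ?bern_weight_ge0//.
rewrite ler_wpM2r ?bern_weight_ge0//.
rewrite (le_trans (binomial_ratio_approx R (leqnn m) mn' _))//; first by rewrite -ltnS.
rewrite mulrA -natrM ler_pdivrMr// mulrC -ler_pdivrMr//.
rewrite (le_trans (ltW (truncnS_gt _)))// ler_nat.
by rewrite leq_subRL ?(ltnW mn')// (leq_trans _ mn)// leq_add2r.
Qed.

(** The cdf is a mixture of indicators, so its step sum is the same mixture of [step_pow]. The bound
    does not depend on n, which lets it survive the limit. *)
Lemma bern_moment_step N m n :
  `|\sum_(k < n.+1) w n k * (k%:R / n%:R) ^+ m - step_sum N.+1 m (bern_cdf n)|
    <= m%:R / N.+1%:R.
Proof.
have -> : step_sum N.+1 m (bern_cdf n) =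
    \sum_(k < n.+1) w n k * step_pow N.+1 m (k%:R / n%:R).
  rewrite /step_pow /step_sum -{1}(sum_bern_weight n).
  under [in RHS]eq_bigr do rewrite mulrBr mulr1.
  rewrite sumrB; congr (_ - _); under [in RHS]eq_bigr do rewrite mulr_sumr.
  rewrite exchange_big /=; apply: eq_bigr => i _; rewrite /bern_cdf mulr_sumr.
  by apply: eq_bigr => k _; rewrite mulrCA.
rewrite -sumrB (le_trans (ler_norm_sum _ _ _))//.
rewrite -[leRHS]mul1r -[X in _ <= X * _](sum_bern_weight n) mulr_suml; apply: ler_sum => k _.
rewrite -mulrBr normrM ger0_norm ?bern_weight_ge0// ler_wpM2l ?bern_weight_ge0//.
by apply: step_pow_approx; rewrite divr_ge0//= bern_node_le1.
Qed.

End BernsteinWeights.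

(** * The Hausdorff moment problem *)

Section Hausdorff.
Variable R : realType.

Lemma ultra_cvg_itv (U : set_system nat) (f : R ^nat) : UltraFilter U ->
  (forall n, f n \in `[0, 1]) ->
  exists l : R, 0 <= l <= 1 /\ (f @ U --> l).
Proof.
move=> UU f01.
have [l [/= l01 cl]] : `[(0 : R), 1]%classic `&` cluster (f @ U) !=set0.
  apply: (@segment_compact R 0 1).
  by rewrite /fmap /=; apply: filterS filterT => n _; exact: f01.
exists l; split; first by move: l01; rewrite /= in_itv.
move=> B lB; have [//|nB] := in_ultra_setVsetC (f @^-1` B) UU.
by have [x []] := cl _ _ (nB : (f @ U) (~` B)) lB.
Qed.

Variable g : R ^nat.
Hypothesis g0 : g 0%N = 1.
Hypothesis gpos : forall j k, 0 <= momf g ('X^j * (1 - 'X) ^+ k).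

(** The ultrafilter refines convergence at infinity, so the discrete moments still tend to g m,
    while a step sum involves only finitely many values of the cdf and converges with them. *)
Lemma exists_limit_cdf : exists G : R -> R,
  [/\ {homo G : x y / x <= y}, forall y, 0 <= G y <= 1,
      forall y, y < 0 -> G y = 0, forall y, 1 <= y -> G y = 1 &
      forall N m, `|g m - step_sum N.+1 m G| <= m%:R / N.+1%:R].
Proof.
have [U [UU ooU]] := @ultraFilterLemma nat \oo _.
have /choice [G GP] y := ultra_cvg_itv UU (fun n => bern_cdf_itv g0 gpos n y).
have GU y : bern_cdf g n y @[n --> U] --> G y by case: (GP y).
exists G; split.
- move=> x y xy; rewrite -(cvg_lim _ (GU x))// -(cvg_lim _ (GU y))//.
  apply: ler_lim; [exact: cvgP (GU x)|exact: cvgP (GU y)|].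
  by apply: nearW => n; exact: bern_cdf_homo.
- by move=> y; case: (GP y).
- move=> y y0; apply: (cvg_unique _ (GU y)) => //.
  by apply: cvg_near_cst; apply: nearW => n; exact: bern_cdf_lt0.
- move=> y y1; apply: (cvg_unique _ (GU y)) => //.
  by apply: cvg_near_cst; apply: nearW => n; exact: bern_cdf_ge1.
move=> N m.
have gm : \sum_(k < n.+1) bern_weight g n k * (k%:R / n%:R) ^+ m @[n --> U] --> g m.
  by move=> B /(bern_moment_cvg g0 gpos); exact: ooU.
have sG : step_sum N.+1 m (bern_cdf g n) @[n --> U] --> step_sum N.+1 m G.
  apply: cvgB; first exact: cvg_cst.
  apply: cvg_big => [|i _]; first exact: add_continuous.
  exact: cvgMl_tmp.
rewrite -(cvg_lim _ (cvg_norm (cvgB gm sG)))//.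
apply: limr_le; first exact: cvgP (cvg_norm (cvgB gm sG)).
by apply: nearW => n; exact: bern_moment_step.
Qed.

(* The right limits of [G], to be used as a distribution function. *)
Definition right_limit (G : R -> R) (y : R) := inf [set G z | z in `]y, +oo[%classic].

Section RightLimit.
Variable G : R -> R.
Hypotheses (Ghomo : {homo G : x y / x <= y}) (G01 : forall y, 0 <= G y <= 1).
Let H := right_limit G.

Lemma right_limit_has_inf y : has_inf [set G z | z in `]y, +oo[%classic].
Proof.
split; first by exists (G (y + 1)), (y + 1) => //; rewrite /= in_itv /= andbT ltrDl.
by exists 0 => _ [z _ <-]; case/andP: (G01 z).
Qed.

Lemma right_limit_lt y z : y < z -> H y <= G z.
Proof.
move=> yz; apply: ge_inf; first by case: (right_limit_has_inf y).
by exists z => //; rewrite /= in_itv /= andbT.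
Qed.

Lemma right_limit_lb y c : (forall z, y < z -> c <= G z) -> c <= H y.
Proof.
move=> cG; apply: lb_le_inf; first by case: (right_limit_has_inf y).
by move=> _ [z /= zy <-]; apply: cG; move: zy; rewrite in_itv /= andbT.
Qed.

Lemma right_limit_ge y : G y <= H y.
Proof. by apply: right_limit_lb => z /ltW; exact: Ghomo. Qed.

Lemma right_limit_homo : nondecreasing H.
Proof.
move=> x y xy; apply: right_limit_lb => z yz; apply: right_limit_lt.
exact: le_lt_trans yz.
Qed.

Lemma right_limit_right_continuous : right_continuous H.
Proof.
move=> x; apply/cvgrPdist_le => e e0.
have [_ [z /= xz <-] Gz] := inf_adherent e0 (right_limit_has_inf x).
move: xz; rewrite in_itv /= andbT => xz.
near=> t.
have xt : x < t by near: t; exact: nbhs_right_gt.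
have tz : t < z by near: t; exact: nbhs_right_lt.
rewrite distrC ger0_norm ?subr_ge0 ?right_limit_homo ?(ltW xt)//.
by rewrite lerBlDl (le_trans (right_limit_lt tz))// ltW.
Unshelve. all: by end_near. Qed.

HB.instance Definition _ := isCumulative.Build R _ R H
  right_limit_homo right_limit_right_continuous.

Hypotheses (G0 : forall y, y < 0 -> G y = 0) (G1 : forall y, 1 <= y -> G y = 1).

Lemma right_limit_lt0 y : y < 0 -> H y = 0.
Proof.
move=> y0; apply/eqP; rewrite eq_le; apply/andP; split.
  have y2 : y < y / 2 by lra.
  by rewrite (le_trans (right_limit_lt y2))// G0//; lra.
by apply: right_limit_lb => z _; case/andP: (G01 z).
Qed.

Lemma right_limit_ge1 y : 1 <= y -> H y = 1.
Proof.
move=> y1; apply/eqP; rewrite eq_le; apply/andP; split.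
  have y2 : y < y + 1 by rewrite ltrDl.
  by rewrite (le_trans (right_limit_lt y2))//; case/andP: (G01 (y + 1)).
by apply: right_limit_lb => z yz; rewrite G1// (le_trans y1)// ltW.
Qed.

Lemma right_limit_cvgNy : H @ -oo --> (0 : R).
Proof.
apply: cvg_near_cst; near=> y; apply: right_limit_lt0.
by near: y; exact: nbhs_ninfty_lt.
Unshelve. all: by end_near. Qed.

Lemma right_limit_cvgy : H @ +oo --> (1 : R).
Proof.
apply: cvg_near_cst; near=> y; apply: right_limit_ge1.
by near: y; exact: nbhs_pinfty_ge.
Unshelve. all: by end_near. Qed.

HB.instance Definition _ := isCumulativeBounded.Build R (0 : R) (1 : R) H
  right_limit_cvgNy right_limit_cvgy.

Definition right_limit_prob : probability (measurableTypeR R) R :=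
  lebesgue_stieltjes_measure H.

Lemma right_limit_probE y : right_limit_prob `]-oo, y]%classic = (H y)%:E.
Proof. by rewrite -cdf_lebesgue_stieltjes_id. Qed.

End RightLimit.

(** Integrability and value are proved together because the induction step for the value needs the
    former. *)
Lemma Rintegral_indic_sum (mu : borel_finite_measure R) (c a : nat -> R) K :
  let f (x : measurableTypeR R) := \sum_(i < K) c i * ((x : R) <= a i)%R%:R in
  mu.-integrable setT (EFin \o f) /\
  \int[mu]_x f x = \sum_(i < K) c i * fine (mu `]-oo, a i]%classic).
Proof.
elim: K => [|K [IH1 IH2]] /=.
  under [X in _.-integrable _ (_ \o X)]eq_fun do rewrite big_ord0.
  split; first exact: finite_measure_integrable_cst.
  under eq_Rintegral do rewrite big_ord0.
  by rewrite Rintegral_cst// mul0r big_ord0.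
have mA := measurable_itvR `]-oo, a K]%R.
have int1 : mu.-integrable setT
    (EFin \o (fun x : measurableTypeR R => ((x : R) <= a K)%R%:R)).
  have := integrable_indic mu mA; congr (_.-integrable _ _).
  by apply/funext => x /=; rewrite indicE mem_setE in_itv.
have intc : mu.-integrable setT
    (EFin \o (fun x : measurableTypeR R => c K * ((x : R) <= a K)%R%:R)).
  have := integrableZl measurableT (c K) int1; congr (_.-integrable _ _).
have E x : \sum_(i < K.+1) c i * (x <= a i)%R%:R =
    \sum_(i < K) c i * (x <= a i)%R%:R + c K * (x <= a K)%R%:R by rewrite big_ord_recr.
split.
  under [X in _.-integrable _ (_ \o X)]eq_fun do rewrite E.
  by have := integrableD measurableT IH1 intc; congr (_.-integrable _ _).
under eq_Rintegral do rewrite E.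
rewrite RintegralD// IH2 big_ord_recr /=; congr (_ + _).
rewrite RintegralZl//; congr (_ * _).
rewrite -[in RHS](setIT `]-oo, a K]%classic) -(integral_indic mu measurableT mA).
by congr fine; apply: eq_integral => x _ /=; rewrite indicE mem_setE in_itv.
Qed.

Lemma hausdorff_moment : exists P : probability (measurableTypeR R) R,
  bounded_by P 1 /\ forall m, moment P m = g m.
Proof.
have [G [Ghomo G01 G0 G1 GS]] := exists_limit_cdf.
pose P := right_limit_prob G01 G0 G1.
have PE y : P `]-oo, y]%classic = (right_limit G y)%:E by exact: right_limit_probE.
have P0 : P `]-oo, (0 : R)[%classic = 0%E.
  (* The distribution function only measures closed half-lines, so the open one is exhausted by
     them. *)
  pose F (k : nat) : set (measurableTypeR R) := `]-oo, - (k.+1%:R^-1 : R)]%classic.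
  have F0 k : P.-negligible (F k).
    apply/(negligibleP _ (measurable_itvR _)); apply: etrans (PE _) _.
    by rewrite right_limit_lt0// oppr_lt0 invr_gt0.
  apply/(negligibleP _ (measurable_itvR _)).
  apply: negligibleS (negligible_bigcup F0) => x /=; rewrite in_itv /= => x0.
  exists (Num.truncn (- x)^-1); first exact: I.
  rewrite /F /= in_itv /= lerNr.
  rewrite -[leRHS]invrK lef_pV2 ?posrE ?invr_gt0 ?oppr_gt0//.
  by rewrite ltW// truncnS_gt.
have PC : P (~` `]-oo, (1 : R)]%classic) = 0%E.
  rewrite probability_setC; last exact: measurable_itvR.
  by rewrite [X in (_ - X)%E](PE 1) right_limit_ge1// subee.
have P01 : P (~` `[(0 : R), 1]%classic) = 0%E.
  have -> : ~` `[(0 : R), 1]%classic = `]-oo, 0[%classic `|` ~` `]-oo, 1]%classic.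
    by rewrite setCitv setCitvl.
  by rewrite measureU0//; exact: measurable_itvC.
have P1 : bounded_by P 1.
  apply: subset_measure0 P01; [exact: measurable_itvC|exact: measurable_itvC|].
  apply: subsetC => x /=; rewrite !in_itv /= => /andP[x0 ->].
  by rewrite (le_trans _ x0)// oppr_le0.
exists P; split=> // m; apply/eqP; rewrite -subr_eq0; apply/eqP.
have Hst N : `|moment P m - step_sum N.+1 m (right_limit G)| <= m%:R / N.+1%:R.
  pose c (i : nat) : R := (i.+1%:R / N.+1%:R) ^+ m - (i%:R / N.+1%:R) ^+ m.
  have [int1 int2] := Rintegral_indic_sum P c (fun i => i%:R / N.+1%:R) N.+1.
  have intX : P.-integrable setT (EFin \o (fun x : measurableTypeR R => (x : R) ^+ m)).
    have := integrable_horner P1 'X^m; congr (_.-integrable _ _).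
    by apply/funext => x /=; rewrite hornerXn.
  have intc : P.-integrable setT (EFin \o cst (1 : R)).
    exact: finite_measure_integrable_cst.
  have ints : P.-integrable setT (EFin \o (fun x : measurableTypeR R => step_pow N.+1 m x)).
    by have := integrableB measurableT intc int1; congr (_.-integrable _ _).
  have -> : step_sum N.+1 m (right_limit G) = \int[P]_x step_pow N.+1 m x.
    rewrite RintegralB// int2; congr (_ - _).
      rewrite Rintegral_cst// mul1r; exact/esym/(congr1 fine (probability_setT P)).
    apply: eq_bigr => i _; congr (_ * _).
    exact/esym/(congr1 fine (PE (i%:R / N.+1%:R))).
  rewrite /moment -RintegralB// -[leRHS]mulr1.
  rewrite -[X in _ <= _ * X](congr1 fine (probability_setT P)).
  apply: (norm_Rintegral_le (measurable_itvR `[0, 1]) P01).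
  - by have := integrableB measurableT intX ints; congr (_.-integrable _ _).
  - by rewrite divr_ge0.
  - by move=> x /=; rewrite in_itv /=; exact: step_pow_approx.
(* Three errors of m / (N + 1): from the moment of P to the step sum of the right limits, from there
   to that of G, and from there to g m. *)
apply: (@eq0_le_inv _ _ (3 * m%:R)) => N.
have GH := @step_sum_dist R N m (right_limit G) G
  (right_limit_ge Ghomo G01) (right_limit_lt G01).
have {GH} : `|step_sum N.+1 m (right_limit G) - step_sum N.+1 m G| <= m%:R / N.+1%:R.
  rewrite (le_trans GH)// ler_piMr ?divr_ge0//.
  have /andP[_] := G01 1; have /andP[] := G01 0; lra.
move: (Hst N) (GS N m); rewrite -[_ * _ / _]mulrA.
set x := m%:R / N.+1%:R; set a := moment P m; set b := g m.
by rewrite !ler_norml => /andP[? ?] /andP[? ?] /andP[? ?]; apply/andP; split; lra.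
Qed.

End Hausdorff.

(** * The compactly supported Hamburger moment problem *)

Section Existence.
Variable R : realType.

Lemma Rintegral_mscale (m : borel_finite_measure R) (k : {nonneg R})
    (f : measurableTypeR R -> R) : m.-integrable setT (EFin \o f) ->
  \int[mscale k m]_x f x = k%:num * \int[m]_x f x.
Proof.
move=> intf; have mf := measurable_int _ intf.
rewrite /Rintegral -[k%:num]/(fine k%:num%:E) -fineM//; last first.
  exact: integrable_fin_num.
congr fine; rewrite integralE [X in _ = (_ * X)%E]integralE !ge0_integral_mscale//.
- by apply: esym; apply: muleBr => //; exact: (integrable_add_def measurableT intf).
- exact: measurable_funeneg.
- exact: measurable_funepos.
Qed.

Definition affine (a b : R) (t : measurableTypeR R) : measurableTypeR R := a * t + b.

Fact measurable_affine a b : measurable_fun setT (affine a b).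
Proof.
apply: (@continuous_measurable_fun R); move=> t; apply: cvgD; last exact: cvg_cst.
by apply: cvgMl_tmp; exact: cvg_id.
Qed.

HB.instance Definition _ a b :=
  isMeasurableFun.Build _ _ _ _ (affine a b) (measurable_affine a b).

Lemma hamburger_moment (s : R ^nat) (C th : R) : 0 < th ->
  (forall q, 0 <= momf s (q ^+ 2)) -> (forall n, `|s n| <= C * th ^+ n) ->
  exists (mu : borel_finite_measure R) (r : R),
    bounded_by mu r /\ forall n, moment mu n = s n.
Proof.
move=> th0 spos sth.
have s0 : 0 <= s 0%N by have := spos 1; rewrite expr1n -(expr0 'X) momfXn.
(* If s 0 = 0, the bound |L(X^n)| <= th^n L(1) makes every moment vanish. *)
have [s00|s00] := eqVneq (s 0%N) 0.
  exists (mzero : borel_finite_measure R), 0; split=> // n.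
  rewrite /moment /Rintegral integral_measure_zero /=; apply/esym/eqP.
  have := momfXM_le spos th0 sth n 1; rewrite expr1n mulr1 -(expr0 'X) !momfXn s00.
  by rewrite mulr0 normr_le0.
have sp : 0 < s 0%N by rewrite lt_def s00.
have th20 : 2 * th != 0 by rewrite mulf_neq0// ?pnatr_eq0// gt_eqF.
(* [r] maps [-th, th] onto [0, 1], and 1 - r is a positive multiple of th - X; dividing by s 0
   normalizes the mass. *)
pose r : {poly R} := (2 * th)^-1 *: ('X + th%:P).
pose g n := (s 0%N)^-1 * momf s (r ^+ n).
have gE p : momf g p = (s 0%N)^-1 * momf s (p \Po r).
  rewrite comp_polyE linear_sum /= [LHS]/momf mulr_sumr; apply: eq_bigr => i _.
  by rewrite linearZ /= /g mulrCA.
have r1 : 1 - r = (2 * th)^-1 *: (th%:P - 'X).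
  rewrite /r -!mul_polyC; apply: (@mulfI _ (2 * th)%:P); first by rewrite polyC_eq0.
  rewrite mulrBr mulr1 !mulrA -polyCM divff// !mul1r rmorphM /= rmorph_nat; ring.
have [P [P1 Pm]] : exists P : probability (measurableTypeR R) R,
    bounded_by P 1 /\ forall m, moment P m = g m.
  apply: hausdorff_moment => [|j k].
    by rewrite /g expr0 -(expr0 'X) momfXn mulVf.
  rewrite gE rmorphM !rmorphXn rmorphB rmorph1 /= comp_polyX r1.
  rewrite !exprZn -scalerAl -scalerAr scalerA linearZ /=.
  rewrite mulr_ge0 ?invr_ge0// mulr_ge0 ?mulr_ge0 ?exprn_ge0 ?invr_ge0 ?mulr_ge0//
    ?(ltW th0)//.
  rewrite mulrC ['X + _]addrC; exact: (momf_endpoints_ge0 spos th0 sth).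
pose mu0 : borel_finite_measure R := distribution P (affine (2 * th) (- th)).
pose mu : borel_finite_measure R := mscale (NngNum s0) mu0.
(* [P] is only recorded as living on [-1, 1], whose image under t -> 2 th t - th is [-3 th, th]. *)
have mu0r : bounded_by mu0 (3 * th).
  apply: subset_measure0 P1; [|exact: measurable_itvC|].
    exact: (measurable_funPTI _ (measurable_itvC _)).
  move=> t; apply: contra_not; rewrite /= !in_itv /= => /andP[t1 t2].
  by rewrite /affine; apply/andP; split; nra.
exists mu, (3 * th); split=> [|n].
  exact: etrans (congr1 (fun x => (s 0%N)%:E * x)%E mu0r) (mule0 _).
have intX (m : borel_finite_measure R) x : bounded_by m x ->
    m.-integrable setT (EFin \o (fun x : measurableTypeR R => (x : R) ^+ n)).
  move=> mx; have := integrable_horner mx 'X^n; congr (_.-integrable _ _).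
  by apply/funext => y /=; rewrite hornerXn.
rewrite /moment Rintegral_mscale /=; last exact: intX mu0r.
pose q : {poly R} := ((2 * th) *: 'X - th%:P) ^+ n.
have -> : \int[mu0]_x (x : R) ^+ n = \int[P]_x q.[x : R].
  rewrite /Rintegral integral_pushforward//.
  - congr fine; apply: eq_integral => x _ /=.
    by rewrite /affine /q horner_exp !hornerE.
  - by apply/measurable_EFinP; apply: measurable_funX.
  - have := integrable_horner P1 q; rewrite preimage_setT; congr (_.-integrable _ _).
    by apply/funext => x /=; rewrite /affine /q horner_exp !hornerE.
rewrite (Rintegral_horner P1) (_ : momf _ _ = momf g q); last first.
  by apply: eq_bigr => i _; rewrite Pm.
rewrite gE mulVKf// -momfXn; congr (momf s _).
rewrite /q rmorphXn rmorphB /= comp_polyC comp_polyZ comp_polyX /r scalerA divff//.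
by rewrite scale1r addrK.
Qed.

End Existence.

(** * Determinacy *)

Section Uniqueness.
Variable R : realType.

(* With [u = b / (K (a + 1 / (k + 1)))] and [n = (k + 1) ^ 2], Bernoulli's
   inequality compares [(1 - u ^ n) ^ (K ^ n)] with [(K u) ^ n], which tends to
   [0] if [b <= a] and to infinity if [a < b]; the shift [1 / (k + 1)] settles
   the boundary case [b = a]. *)
Definition step_seq (K : nat) (a b : R) (k : nat) : R :=
  (1 - (b / (K%:R * (a + k.+1%:R^-1))) ^+ (k.+1 ^ 2)) ^+ (K ^ (k.+1 ^ 2)).

(** Bernoulli replaces 1 + N z by (1 + z)^N, and (1 - z^2)^N <= 1. *)
Lemma onem_exp_le (z : R) N : 0 <= z <= 1 -> (1 - z) ^+ N * (1 + N%:R * z) <= 1.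
Proof.
move=> /andP[z0 z1]; have z10 : 0 <= 1 - z by rewrite subr_ge0.
apply: (@le_trans _ _ ((1 - z) ^+ N * (1 + z) ^+ N)).
  rewrite ler_wpM2l ?exprn_ge0//; apply: bernoulli_ineq.
  by rewrite (le_trans _ z0)// lerN10.
by rewrite -exprMn exprn_ile1//; nra.
Qed.

Section StepSeq.
Variables (K : nat) (a b : R).
Hypotheses (K0 : (0 < K)%N) (a0 : 0 < a) (b0 : 0 <= b) (ba : b <= K%:R * a).
Let d k := a + k.+1%:R^-1.
Let z k := (b / (K%:R * d k)) ^+ (k.+1 ^ 2).

Let d0 k : 0 < d k. Proof. by rewrite addr_gt0. Qed.

Let K0R : 0 < K%:R :> R. Proof. by rewrite ltr0n. Qed.

Let z01 k : 0 <= z k <= 1.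
Proof.
have u0 : 0 <= b / (K%:R * d k) by rewrite divr_ge0// mulr_ge0// ltW.
rewrite exprn_ge0//= exprn_ile1// ler_pdivrMr ?mulr_gt0// mul1r (le_trans ba)//.
by rewrite ler_wpM2l// lerDl.
Qed.

Let Kz k : (K ^ (k.+1 ^ 2))%:R * z k = (b / d k) ^+ (k.+1 ^ 2).
Proof.
by rewrite natrX -exprMn; congr (_ ^+ _); field; rewrite !gt_eqF.
Qed.

Lemma step_seq_itv k : 0 <= step_seq K a b k <= 1.
Proof.
have /andP[z0 z1] := z01 k.
by rewrite exprn_ge0 ?subr_ge0//= exprn_ile1 ?subr_ge0// lerBlDr lerDl.
Qed.

Lemma step_seq_cvg1 : b <= a -> step_seq K a b k @[k --> \oo] --> (1 : R).
Proof.
move=> bLa; apply/cvgrPdist_le => e e0.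
near=> k; have /andP[_ s1] := step_seq_itv k.
rewrite ger0_norm ?subr_ge0//.
have /andP[z0 z1] := z01 k.
have := @bernoulli_ineq R (- z k) (K ^ (k.+1 ^ 2)); rewrite lerN2 mulrN Kz => /(_ z1).
rewrite -/(step_seq K a b k) => /(lerB (lexx 1)) /le_trans; apply.
rewrite opprB addrC subrK.
have k0 : 0 < k.+1%:R :> R by [].
apply: (@le_trans _ _ ((a / d k) ^+ (k.+1 ^ 2))).
  rewrite lerXn2r ?nnegrE ?divr_ge0 ?(ltW (d0 _)) ?(ltW a0)//.
  by rewrite ler_wpM2r ?invr_ge0 ?(ltW (d0 _)).
rewrite -[a / _]invrK exprVn invf_div.
have -> : d k / a = 1 + (k.+1%:R * a)^-1.
  by rewrite /d; field; rewrite !gt_eqF.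
(* The squared exponent outweighs the shift: Bernoulli yields (k + 1)^2 / ((k + 1) a), which is
   unbounded. *)
have h : k.+1%:R / a <= (1 + (k.+1%:R * a)^-1) ^+ (k.+1 ^ 2).
  apply: le_trans (bernoulli_ineq _ _); last first.
    by rewrite (@le_trans _ _ 0)// ?invr_ge0 ?mulr_ge0 ?(ltW a0)// oppr_le0.
  rewrite natrX (_ : _ * _^-1 = k.+1%:R / a); first by rewrite lerDr.
  by field; rewrite !gt_eqF.
apply: (@le_trans _ _ (k.+1%:R / a)^-1).
  by rewrite lef_pV2 ?posrE ?divr_gt0// (lt_le_trans _ h)// divr_gt0.
rewrite invf_div ler_pdivrMr// mulrC -ler_pdivrMr//.
rewrite (@le_trans _ _ k%:R) ?ler_nat//; near: k; exact: nbhs_infty_ger.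
Unshelve. all: by end_near. Qed.

Lemma step_seq_cvg0 : a < b -> step_seq K a b k @[k --> \oo] --> (0 : R).
Proof.
move=> ab; apply/cvgrPdist_le => e e0.
(* 1 + del is the midpoint between 1 and b / a, the limit of b / d k. *)
pose del := (b - a) / (2 * a).
have del0 : 0 < del by rewrite divr_gt0 ?mulr_gt0// subr_gt0.
near=> k; have /andP[s0 _] := step_seq_itv k.
rewrite sub0r normrN ger0_norm//.
have k0 : 0 < k.+1%:R :> R by [].
have vd : 1 + del <= b / d k.
  rewrite ler_pdivlMr// /d mulrDr.
  have kM : (1 + del) / ((b - a) / 2) <= k.+1%:R.
    rewrite (@le_trans _ _ k%:R) ?ler_nat//; near: k; exact: nbhs_infty_ger.
  have h : (1 + del) / k.+1%:R <= (b - a) / 2.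
    by rewrite ler_pdivrMr// mulrC -ler_pdivrMr// divr_gt0// subr_gt0.
  have -> : (1 + del) * a = (a + b) / 2 by rewrite /del; field; rewrite gt_eqF.
  by move: h; set y := _ / k.+1%:R; lra.
have kd : k.+1%:R * del <= (b / d k) ^+ (k.+1 ^ 2).
  apply: (@le_trans _ _ ((1 + del) ^+ (k.+1 ^ 2))); last first.
    apply: lerXn2r => //; rewrite nnegrE.
      by rewrite addr_ge0// ltW.
    by rewrite divr_ge0// ltW.
  apply: le_trans (bernoulli_ineq _ _); last first.
    by rewrite (le_trans _ (ltW del0))// oppr_le0.
  rewrite (@le_trans _ _ ((k.+1 ^ 2)%:R * del)) ?lerDr//.
  by rewrite ler_wpM2r ?(ltW del0)// ler_nat -{1}[k.+1]expn1 leq_pexp2l.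
have kdel : 0 < k.+1%:R * del by rewrite mulr_gt0.
rewrite -(ler_pM2r kdel) (@le_trans _ _ 1)//.
  apply: le_trans (onem_exp_le (K ^ (k.+1 ^ 2)) (z01 k)); rewrite Kz.
  by rewrite ler_wpM2l// (le_trans kd)// lerDr.
rewrite -ler_pdivrMl// mulr1 -ler_pdivrMr//.
rewrite (@le_trans _ _ k%:R) ?ler_nat//; near: k; exact: nbhs_infty_ger.
Unshelve. all: by end_near. Qed.

End StepSeq.

Definition step_poly (K : nat) (A y : R) (k : nat) : {poly R} :=
  (1 - ((K%:R * (y + A + k.+1%:R^-1))^-1 *: ('X + A%:P)) ^+ (k.+1 ^ 2))
    ^+ (K ^ (k.+1 ^ 2)).

Lemma horner_step_poly K A y k t :
  (step_poly K A y k).[t] = step_seq K (y + A) (t + A) k.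
Proof. by rewrite /step_poly !(horner_exp, hornerE) /step_seq [_^-1 * _]mulrC. Qed.

(** The left side depends on mu only through its moments, hence so does the distribution function.
    Domination by 1 holds on [-r, r], where all the mass lies. *)
Lemma moment_cdf_cvg (mu : borel_finite_measure R) (r y : R) (K : nat) :
  bounded_by mu r -> 0 <= r -> - r <= y -> 2 * r + 1 <= K%:R ->
  momf (moment mu) (step_poly K (r + 1) y k) @[k --> \oo] -->
    fine (mu `]-oo, y]%classic).
Proof.
move=> mur r0 ry rK.
have mD := measurable_itvR `[(- r), r]; have mA := measurable_itvR `]-oo, y].
have Kn : (0 < K)%N by rewrite -(ltr_nat R); lra.
pose f_ k (x : measurableTypeR R) : \bar R := ((step_poly K (r + 1) y k).[x : R])%:E.
pose f (x : measurableTypeR R) : \bar R := (\1_(`]-oo, y]%classic) x)%:E.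
(* Translating by r + 1 gives y + (r + 1) >= 1 and 0 <= x + (r + 1) <= 2 r + 1 <= K, as [step_seq]
   requires. *)
have pos x : - r <= x -> 0 <= x + (r + 1) by lra.
have yr : 0 < y + (r + 1) by lra.
have upp x : x <= r -> x + (r + 1) <= K%:R * (y + (r + 1)).
  move=> xr; rewrite (@le_trans _ _ K%:R)//; first by lra.
  by rewrite ler_peMr//; lra.
have := @dominated_convergence _ _ R mu `[(- r), r]%classic mD f_ f (cst 1%E).
case.
- by move=> k; apply/measurable_EFinP; apply: measurable_funTS; exact: measurable_horner.
- by apply/measurable_EFinP; exact: measurable_indic.
- apply: aeW => x /=; rewrite in_itv /= => /andP[rx xr].
  rewrite /f_ /f indicE; apply: cvg_EFin; first exact: nearW.
  rewrite (_ : fine \o _ = step_seq K (y + (r + 1)) (x + (r + 1))); last first.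
    by apply/funext => k; rewrite /= horner_step_poly.
  rewrite mem_setE in_itv /=; case: leP => xy.
    by apply: step_seq_cvg1 => //; [exact: pos|exact: upp|rewrite lerD2r].
  by apply: step_seq_cvg0 => //; [exact: pos|exact: upp|rewrite ltrD2r].
- exact: finite_measure_integrable_cst.
- apply: aeW => x k /=; rewrite in_itv /= => /andP[rx xr].
  rewrite /f_ horner_step_poly lee_fin ger0_norm.
    by case/andP: (step_seq_itv Kn yr (pos _ rx) (upp _ xr) k).
  by case/andP: (step_seq_itv Kn yr (pos _ rx) (upp _ xr) k).
move=> _ _.
pose D : set (measurableTypeR R) := `[(- r), r]%classic.
have -> : (\int[mu]_(x in D) f x)%E = mu `]-oo, y]%classic.
  rewrite /f integral_indic//.
  rewrite -[X in _ = mu X](setUIDK `]-oo, y]%classic `[(- r), r]%classic).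
  apply/esym/measureU0; [exact: measurableI|exact: measurableD|].
  apply: subset_measure0 mur; [exact: measurableD|exact: measurable_itvC|].
  by move=> x [].
rewrite -(fineK (fin_num_measure mu _ mA)).
move=> /fine_cvg; apply: cvg_trans; apply: near_eq_cvg; apply: nearW => k.
rewrite -(Rintegral_horner mur) /Rintegral /=; congr fine.
rewrite (negligible_integral (measurable_itvC `[(- r), r]) measurableT _ mur).
  by rewrite setTD setCK.
exact: (integrable_horner mur (step_poly K (r + 1) y k)).
Qed.

Lemma moment_unique (mu1 mu2 : borel_finite_measure R) (r1 r2 : R) :
  bounded_by mu1 r1 -> bounded_by mu2 r2 ->
  (forall n, moment mu1 n = moment mu2 n) ->
  forall A : set (measurableTypeR R), measurable A -> mu1 A = mu2 A.
Proof.
move=> mur1 mur2 eqm.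
pose r : R := Num.max 0 (Num.max r1 r2).
have mu1r : bounded_by mu1 r by apply: bounded_byW mur1; rewrite !le_max lexx !orbT.
have mu2r : bounded_by mu2 r by apply: bounded_byW mur2; rewrite !le_max lexx !orbT.
have r0 : 0 <= r by rewrite le_max lexx.
have cdfE y : mu1 `]-oo, y]%classic = mu2 `]-oo, y]%classic.
  have mA := measurable_itvR `]-oo, y].
  have [ry|yr] := leP (- r) y; last first.
    have sub : `]-oo, y]%classic `<=` ~` `[(- r), r]%classic.
      move=> x /=; rewrite !in_itv /= => xy /andP[rx _].
      by have := le_lt_trans (le_trans rx xy) yr; rewrite ltxx.
    transitivity (0 : \bar R).
      exact: subset_measure0 mA (measurable_itvC _) sub mu1r.
    exact/esym/(subset_measure0 mA (measurable_itvC _) sub mu2r).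
  have rK : 2 * r + 1 <= (Num.truncn (2 * r + 1)).+1%:R by rewrite ltW// truncnS_gt.
  have c1 := moment_cdf_cvg mu1r r0 ry rK; have c2 := moment_cdf_cvg mu2r r0 ry rK.
  have e12 p : momf (moment mu1) p = momf (moment mu2) p.
    by apply: eq_bigr => i _; rewrite eqm.
  have : fine (mu1 `]-oo, y]%classic) = fine (mu2 `]-oo, y]%classic).
    apply: (cvg_unique _ c1) => //; move: c2; apply: cvg_trans.
    by apply: near_eq_cvg; apply: nearW => k; rewrite e12.
  by move=> e; rewrite -(fineK (fin_num_measure mu1 _ mA)) e fineK// fin_num_measure.
have ocE a b : mu1 `]a, b]%classic = mu2 `]a, b]%classic.
  have [ab|ba] := leP a b; last by rewrite set_itv_ge ?measure0// bnd_simp -leNgt ltW.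
  have -> : `]a, b]%classic = `]-oo, b]%classic `\` `]-oo, a]%classic :> set R.
    by rewrite -[RHS]setCK setCD setCitvl setUC -[LHS]setCK setCitv.
  have ma := measurable_itvR `]-oo, a]; have mb := measurable_itvR `]-oo, b].
  have sub : `]-oo, a]%classic `<=` (`]-oo, b]%classic : set R).
    by apply: subset_itvl; rewrite bnd_simp.
  rewrite !measureD//; try by rewrite -ge0_fin_numE// fin_num_measure.
  by rewrite !setIidr//; congr (_ - _)%E; exact: cdfE.
move=> A mA.
apply: (@measure_unique _ R (measurableTypeR R) (@ocitv R)
  (fun n : nat => `](- n%:R), n%:R]%classic)) => //.
- exact: ocitvI.
- by move=> n; exact: is_ocitv.
- exact: bigcup_itvT.
- by move=> _ [[a b] _ <-]; exact: ocE.
- by move=> n; rewrite -ge0_fin_numE// fin_num_measure//; exact: measurable_itvR.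
Qed.

End Uniqueness.

(** * The representing triplet *)

Section Representation.
Variable R : realType.
Implicit Types (mu nu : borel_finite_measure R) (gamma : R ^nat).

(** Truncated subtraction makes the formula valid for every j, beyond the degree included. *)
Lemma coef_Qpoly n j : (Qpoly R n)`_j = (n - j - 1)%:R.
Proof.
rewrite /Qpoly coef_sum; under eq_bigr do rewrite coefZ coefXn.
rewrite big_mkord; case: (ltnP j n.-1) => jn.
  rewrite (bigD1 (Ordinal jn))//= eqxx mulr1 big1 ?addr0// => i ij.
  case: eqP => [e|_]; last by rewrite mulr0.
  by case/eqP: ij; apply: val_inj.
rewrite big1 => [|i _]; first by have -> : (n - j - 1 = 0)%N by lia.
by rewrite gtn_eqF ?mulr0// (leq_trans _ jn).
Qed.

(** The coefficient max(n - j - 1, 0) is piecewise linear in n, so its second difference is 1 at n =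
    j and 0 elsewhere. *)
Lemma Qpoly_diff2 n : Qpoly R n.+2 - 2 *: Qpoly R n.+1 + Qpoly R n = 'X^n.
Proof.
apply/polyP => j; rewrite !(coefD, coefN, coefZ, coef_Qpoly) coefXn.
case: (ltngtP j n) => jn.
- have -> : (n.+2 - j - 1 = (n - j - 1) + 2)%N by lia.
  have -> : (n.+1 - j - 1 = (n - j - 1) + 1)%N by lia.
  by rewrite !natrD /=; ring.
- have -> : (n.+2 - j - 1 = 0)%N by lia.
  have -> : (n.+1 - j - 1 = 0)%N by lia.
  have -> : (n - j - 1 = 0)%N by lia.
  by rewrite /=; ring.
- have -> : (n.+2 - j - 1 = 1)%N by lia.
  have -> : (n.+1 - j - 1 = 0)%N by lia.
  have -> : (n - j - 1 = 0)%N by lia.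
  by rewrite /=; ring.
Qed.

Lemma Qpoly_lt2 n : (n < 2)%N -> Qpoly R n = 0.
Proof.
by move=> n2; apply/polyP => j; rewrite coef_Qpoly coef0 (_ : _ - _ = 0)%N//; lia.
Qed.

Lemma diff2_inj (f h : R ^nat) : f 0%N = h 0%N -> f 1%N = h 1%N ->
  (forall n, diff2 f n = diff2 h n) -> forall n, f n = h n.
Proof.
move=> e0 e1 e2 n; suff: f n = h n /\ f n.+1 = h n.+1 by case.
elim: n => [//|n [IH1 IH2]]; split=> //.
have := e2 n; rewrite /diff2 IH1 IH2; lra.
Qed.

(** Equality of sequences is tested on the first two terms and the second differences. The term n =
    0 is automatic, n = 1 gives b, and c n^2 contributes 2c. *)
Lemma representsP gamma b c nu r : bounded_by nu r ->
  (forall n : nat, gamma n = gamma 0%N + b * n%:R + c * n%:R ^+ 2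
                      + \int[nu]_x (Qpoly R n).[x : R]) <->
  b = gamma 1%N - gamma 0%N - c /\ forall n, diff2 gamma n = moment nu n + 2 * c.
Proof.
move=> nur.
pose f n := gamma 0%N + b * n%:R + c * n%:R ^+ 2 + momf (moment nu) (Qpoly R n).
have f0 : f 0%N = gamma 0%N by rewrite /f Qpoly_lt2// linear0; ring.
have f1 : f 1%N = gamma 0%N + b + c by rewrite /f Qpoly_lt2// linear0; ring.
have f2 n : diff2 f n = moment nu n + 2 * c.
  rewrite -(momfXn (moment nu)) -Qpoly_diff2 linearD linearB linearZ /= /diff2 /f.
  by rewrite -!natr1; ring.
split=> [H|[bE H] n].
  have gf n : gamma n = f n by rewrite H (Rintegral_horner nur).
  by split=> [|n]; [rewrite gf f1; ring|rewrite -f2 /diff2 -!gf].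
rewrite (Rintegral_horner nur) -/(f n); apply: diff2_inj => [||m]; first exact/esym.
  by rewrite f1 bE; ring.
by rewrite f2 H.
Qed.

(** * The combined measure with an atom at 1 *)

Section AddAtom.
Local Notation dirac1 := (@dirac _ (measurableTypeR R) (1 : R) R).
Variables (nu : borel_finite_measure R) (k : {nonneg R}).

Definition add_atom1 : set (measurableTypeR R) -> \bar R :=
  measure_add nu (mscale k dirac1).

HB.instance Definition _ := Measure.on add_atom1.

Lemma add_atom1E A : add_atom1 A = (nu A + k%:num%:E * dirac1 A)%E.
Proof. exact: measure_addE. Qed.

Fact add_atom1_fin_num : fin_num_fun add_atom1.
Proof.
by move=> A mA; rewrite add_atom1E fin_numD fin_num_measure.
Qed.

HB.instance Definition _ := Measure_isFinite.Build _ _ _ add_atom1 add_atom1_fin_num.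

Lemma bounded_by_add_atom1 r : bounded_by nu r -> bounded_by add_atom1 (Num.max r 1).
Proof.
move=> nur; apply: etrans (add_atom1E _) _.
rewrite (bounded_byW _ nur) ?le_max ?lexx// add0e diracE.
rewrite memNset ?mule0// => /=; apply.
by rewrite in_itv /= lerNl !le_max lexx (le_trans (lerN10 _) ler01) !orbT.
Qed.

Lemma moment_add_atom1 r n : bounded_by nu r ->
  moment add_atom1 n = moment nu n + k%:num.
Proof.
move=> nur.
pose d : borel_finite_measure R := mscale k dirac1.
have d1 : bounded_by (dirac1 : borel_finite_measure R) 1.
  rewrite /bounded_by -[LHS]/(dirac1 (~` `[(- 1), 1]%classic)) diracE memNset// => /=; apply.
  by rewrite in_itv /= lexx andbT (le_trans _ ler01)// lerN10.
have intX (m : borel_finite_measure R) x : bounded_by m x ->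
    m.-integrable setT (EFin \o (fun x : measurableTypeR R => (x : R) ^+ n)).
  move=> mx; have := integrable_horner mx 'X^n; congr (_.-integrable _ _).
  by apply/funext => y /=; rewrite hornerXn.
have intd : d.-integrable setT (EFin \o (fun x : measurableTypeR R => (x : R) ^+ n)).
  apply: (intX _ 1); exact: etrans (congr1 (fun x => k%:num%:E * x)%E d1) (mule0 _).
rewrite /moment /Rintegral integral_measure_add//; last exact: (intX _ _ nur).
rewrite fineD; [congr (_ + _)|exact: integrable_fin_num (intX _ _ nur)|
  exact: integrable_fin_num intd].
apply: etrans (Rintegral_mscale k (intX _ _ d1)) _.
rewrite /Rintegral integral_dirac//; last exact: measurable_int (intX _ _ d1).
by rewrite diracT mul1e /= expr1n mulr1.
Qed.

End AddAtom.

Lemma diff2_moment gamma b c nu (k : {nonneg R}) : k%:num = 2 * c ->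
  represents gamma b c nu ->
  exists2 r, bounded_by (add_atom1 nu k) r &
    forall n, diff2 gamma n = moment (add_atom1 nu k) n.
Proof.
move=> kE [c0 /compact_msupport_bounded [r r0 /msupport_bounded_by nur] _].
move=> /(representsP gamma b c nur) [_ H]; exists (Num.max r 1).
  exact: bounded_by_add_atom1.
by move=> n; rewrite (moment_add_atom1 _ _ nur) kE.
Qed.

(** With th < M < t, the mass m off [-t, t] satisfies t^(2n) m <= M^(2n) for large n, so (t /
    M)^(2n) m stays bounded and m = 0. *)
Lemma growth_bounded_by mu r th t : bounded_by mu r -> th < t ->
  growth_rates (moment mu) th -> bounded_by mu t.
Proof.
move=> mur tht gth; have th0 : 0 <= th by case: gth.
have t0 : 0 < t by exact: le_lt_trans tht.
pose M := (th + t) / 2; have thM : th < M by rewrite /M; lra.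
have M0 : 0 < M by exact: le_lt_trans thM.
have Mt : M < t by rewrite /M; lra.
have [N _ HN] := growth_rates_lt thM gth.
have mC := measurable_itvC `[(- t), t].
rewrite /bounded_by -(fineK (fin_num_measure mu _ mC)); congr EFin.
set m := fine _; have m0 : 0 <= m by rewrite fine_ge0.
pose del := t / M - 1; have del0 : 0 < del by rewrite subr_gt0 ltr_pdivlMr// mul1r.
have H n : (N <= n)%N -> n%:R * del * m <= 1.
  move=> Nn; have N2 : (N <= 2 * n)%N by lia.
  have := le_trans (moment_ge mur n (ltW t0)) (le_trans (ler_norm _) (HN _ N2)).
  rewrite -/m mulrC -ler_pdivlMr ?exprn_gt0// -invf_div -expr_div_n.
  have tM : 1 + n%:R * del <= (t / M) ^+ (2 * n).
    have -> : t / M = 1 + del by rewrite /del addrC subrK.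
    have := @bernoulli_ineq R del (2 * n); rewrite natrM => h.
    apply: le_trans (h _); last by rewrite (le_trans _ (ltW del0))// oppr_le0.
    by rewrite lerD2l ler_wpM2r ?(ltW del0)// ler_peMl// ler1n.
  have tM0 : 0 < (t / M) ^+ (2 * n) by rewrite exprn_gt0// divr_gt0.
  move=> h; rewrite (@le_trans _ _ ((t / M) ^+ (2 * n) * m))//.
    by rewrite ler_wpM2r// (le_trans _ tM)// lerDr.
  by rewrite mulrC -ler_pdivlMr// mul1r.
apply: (@eq0_le_inv R _ ((1 + N%:R * del * m) / del)) => n.
rewrite ger0_norm// mulrAC ler_pdivlMr// ler_pdivlMr//.
have := H (N + n.+1)%N (leq_addr _ _); rewrite natrD.
have : 0 <= N%:R * del * m by rewrite !mulr_ge0// ltW.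
by nra.
Qed.

End Representation.

(** * Existence and uniqueness of the triplet, root growth and support *)

Section RootGrowth.
Variable R : realType.
Implicit Types (mu nu : borel_finite_measure R) (gamma : R ^nat).

Lemma nonneg_double (c : R) : 0 <= c -> exists k : {nonneg R}, k%:num = 2 * c.
Proof.
move=> c0; have c20 : 0 <= 2 * c by rewrite mulr_ge0.
by exists (NngNum c20).
Qed.

Lemma exists_represents gamma th : cond_pos_def gamma -> growth_rates gamma th ->
  exists b c nu, represents gamma b c nu.
Proof.
move=> /cond_pos_defP pos gth; have th0 : 0 <= th by case: gth.
have [_ [C [C0 sC]]] := growth_rates_diff2 th0 gth.
(* [th] may be 0, while the moment problem is solved for a positive radius. *)
have th1 : 0 < th + 1 by rewrite ltr_wpDl.
have sC1 n : `|diff2 gamma n| <= C * (th + 1) ^+ n.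
  by rewrite (le_trans (sC n))// ler_wpM2l// lerXn2r ?nnegrE ?addr_ge0// lerDl.
have [mu [r [mur mum]]] := hamburger_moment th1 pos sC1.
have m1 : measurable ([set (1 : R)] : set (measurableTypeR R)).
  exact: measurable_set1.
(* The mass of mu at 1 is moved into the quadratic term, with c half of that mass. *)
pose nu : borel_finite_measure R := mrestr mu (measurableC m1).
have nuE A : nu A = mu (A `&` ~` [set (1 : R)]) by [].
pose c := fine (mu [set (1 : R)]) / 2.
have c0 : 0 <= c by rewrite divr_ge0 ?fine_ge0.
have nur : bounded_by nu r.
  apply: subset_measure0 mur; [|exact: measurable_itvC|exact: subIsetl].
  by apply: measurableI; [exact: measurable_itvC|exact: measurableC].
have [k kE] := nonneg_double c0.
have muE A : measurable A -> mu A = add_atom1 nu k A.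
  move=> mA; rewrite add_atom1E nuE kE /c mulrCA divff ?pnatr_eq0// mulr1.
  rewrite -setDE diracE fineK ?fin_num_measure// (measureDI mu mA m1).
  congr (_ + _)%E; case: (boolP (1 \in A)) => [A1|nA1].
    rewrite mule1; congr (mu _); rewrite setIC setIidl// => x ->.
    by move: A1; rewrite inE.
  rewrite mule0 -[RHS](measure0 mu); congr (mu _); rewrite -subset0 => x [Ax x1].
  by move/negP: nA1; apply; rewrite inE -x1.
have numu n : moment mu n = moment (add_atom1 nu k) n.
  rewrite /moment /Rintegral; congr fine.
  by apply: eq_measure_integral => A mA _; exact: muE.
exists (gamma 1%N - gamma 0%N - c), c, nu; split=> //.
- exact: bounded_by_compact nur.
- by rewrite nuE setICr measure0.
- apply/(representsP _ _ _ nur); split=> // n.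
  by rewrite -kE -(moment_add_atom1 _ _ nur) -numu mum.
Qed.

Lemma represents_cond_pos_def gamma b c nu :
  represents gamma b c nu -> cond_pos_def gamma.
Proof.
move=> H; have [c0 _ _ _] := H; have [k kE] := nonneg_double c0.
have [r mur mum] := diff2_moment kE H.
apply/cond_pos_defP => q; rewrite (_ : momf _ _ = momf (moment (add_atom1 nu k)) (q ^+ 2)).
  exact: momf_moment_sqr_ge0 mur _.
by apply: eq_bigr => i _; rewrite mum.
Qed.

(** The combined measure lives on [-max(r, 1), max(r, 1)], so its moments grow at most at that rate;
    undoing two differences requires a rate above 1. *)
Lemma represents_growth_rates gamma b c nu r th : represents gamma b c nu ->
  bounded_by nu r -> Num.max 1 r < th -> growth_rates gamma th.
Proof.
move=> H nur rth; have [c0 _ _ /(representsP _ _ _ nur) [_ Hd]] := H.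
have [k kE] := nonneg_double c0.
have mur := bounded_by_add_atom1 k nur.
set t := Num.max r 1 in mur.
have t1 : 1 <= t by rewrite le_max lexx orbT.
have t0 := le_trans ler01 t1.
have tth : t < th by rewrite /t maxC.
apply: diff2_growth_rates; first exact: le_lt_trans tth.
split; first exact: le_trans t0 (ltW tth).
exists (fine (add_atom1 nu k setT)); split=> [|n]; first by rewrite fine_ge0.
rewrite Hd -kE -(moment_add_atom1 _ _ nur) (le_trans (moment_le mur _ t0))// mulrC.
rewrite ler_wpM2l ?fine_ge0// lerXn2r ?nnegrE// ?(ltW tth)//.
exact: le_trans t0 (ltW tth).
Qed.

(** Determinacy fixes the combined measure. Its mass at 1 is 2c because nu({1}) = 0; subtracting the
    atom gives nu, and n = 1 gives b. *)
Lemma represents_unique gamma b c nu b' c' nu' :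
  represents gamma b c nu -> represents gamma b' c' nu' ->
  [/\ b' = b, c' = c &
      forall A : set (measurableTypeR R), measurable A -> nu' A = nu A].
Proof.
move=> H H'; have [c0 cpt nu1 Hg] := H; have [c'0 cpt' nu'1 Hg'] := H'.
have [k kE] := nonneg_double c0; have [k' k'E] := nonneg_double c'0.
have [r mur mum] := diff2_moment kE H; have [r' mur' mum'] := diff2_moment k'E H'.
have E A : measurable A -> add_atom1 nu' k' A = add_atom1 nu k A.
  by apply: (moment_unique mur' mur) => n; rewrite -mum -mum'.
have m1 : measurable ([set (1 : R)] : set (measurableTypeR R)).
  exact: measurable_set1.
have kk : k'%:num = k%:num :> R.
  have := E _ m1; rewrite !add_atom1E nu1 nu'1 !add0e diracE mem_set// !mule1.
  by case.
have cc : c' = c by move: kk; rewrite kE k'E; lra.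
split=> // [|A mA].
  have := Hg 1%N; rewrite (Hg' 1%N) cc /Rintegral Qpoly_lt2//.
  under eq_integral do rewrite horner0.
  under [X in _ = _ + fine X]eq_integral do rewrite horner0.
  by rewrite !integral0 /=; lra.
have := E _ mA; rewrite !add_atom1E kk diracE => /(congr1 fine).
have kfin : (k%:num%:E * ((1 : R) \in A)%:R%:E)%E \is a fin_num by rewrite -EFinM.
rewrite !fineD ?fin_num_measure// => /addIr e.
by rewrite -(fineK (fin_num_measure nu' _ mA)) e fineK// fin_num_measure.
Qed.

(** A sum of measures is null off [-t, t] only if both summands are; for c > 0 the atom at 1 must
    then lie in [-t, t]. *)
Lemma represents_bounded_by gamma b c nu th t : represents gamma b c nu ->
  growth_rates gamma th -> th < t -> bounded_by nu t /\ (0 < c -> 1 <= t).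
Proof.
move=> H gth tht; have [c0 _ _ _] := H; have [k kE] := nonneg_double c0.
have [r mur mum] := diff2_moment kE H.
have th0 : 0 <= th by case: gth.
have : growth_rates (moment (add_atom1 nu k)) th.
  have [_ [C [C0 sC]]] := growth_rates_diff2 th0 gth; split=> //.
  by exists C; split=> // n; rewrite -mum.
move=> /(growth_bounded_by mur tht) /(etrans (esym (add_atom1E _ _ _))) /eqP.
rewrite padde_eq0//; last by rewrite mule_ge0.
move=> /andP[/eqP nut /eqP d1]; split=> // cp.
rewrite leNgt; apply/negP => t1; move: d1; rewrite diracE mem_set /=.
  by rewrite mule1 => -[]; rewrite kE; lra.
by rewrite in_itv /= => /andP[_]; rewrite leNgt t1.
Qed.

Lemma msupport_limsup_root gamma b c nu x : represents gamma b c nu ->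
  msupport nu x -> (`|x|%:E <= limsup_root gamma)%E.
Proof.
move=> H nux; rewrite leNgt; apply/negP => /limsup_root_ltP [th gth thx].
have tht : th < (th + `|x|) / 2 by lra.
have [/bounded_by_msupport nut _] := represents_bounded_by H gth tht.
by have := nut _ nux; rewrite /= in_itv /= -ler_norml; lra.
Qed.

Lemma limsup_root_ge1 gamma b c nu : represents gamma b c nu -> 0 < c ->
  (1 <= limsup_root gamma)%E.
Proof.
move=> H cp; rewrite leNgt; apply/negP => /limsup_root_ltP [th gth th1].
have tht : th < (th + 1) / 2 by lra.
by have [_ /(_ cp)] := represents_bounded_by H gth tht; lra.
Qed.

Lemma limsup_root_le_max gamma b c nu : represents gamma b c nu ->
  (limsup_root gamma <= Order.max 1 (sup_abs_support nu))%E.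
Proof.
move=> H; have [_ /compact_msupport_bounded [r r0 sub] _ _] := H.
have supr : (sup_abs_support nu <= r%:E)%E.
  apply/ereal_supP => _ [x nux <-].
  by have := sub _ nux; rewrite /= in_itv /= -ler_norml lee_fin.
(* The maximum with 1 is finite even for an empty support, where the supremum is -oo. *)
have fin : Order.max 1%E (sup_abs_support nu) \is a fin_num.
  by rewrite fin_numElt lt_max ltNyr gt_max ltry (le_lt_trans supr) ?ltry.
rewrite -(fineK fin); set s := fine _.
have s1 : 1 <= s by rewrite -lee_fin /s fineK// le_max lexx.
have nus : bounded_by nu s.
  apply: msupport_bounded_by => x nux; rewrite /= in_itv /= -ler_norml.
  rewrite -lee_fin /s fineK// le_max; apply/orP; right.
  by apply: ereal_sup_ubound; exists x.
apply/lee_addgt0Pr => e e0; rewrite -EFinD; apply: limsup_root_le.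
by apply: (represents_growth_rates H nus); rewrite (max_idPr s1) ltrDl.
Qed.

End RootGrowth.

Theorem theorem2p2p5 (R : realType) (gamma : R ^nat) :
  ((cond_pos_def gamma /\
      exists alpha theta : R, [/\ 0 <= alpha, 0 <= theta &
        forall n : nat, `|gamma n| <= alpha * theta ^+ n])
     <-> (cond_pos_def gamma /\ (limsup_root gamma < +oo)%E)) /\
  ((cond_pos_def gamma /\ (limsup_root gamma < +oo)%E)
     <-> exists (b c : R) (nu : borel_finite_measure R),
           represents gamma b c nu) /\
  (forall (b c : R) (nu : borel_finite_measure R), represents gamma b c nu ->
     (forall (b' c' : R) (nu' : borel_finite_measure R),
        represents gamma b' c' nu' ->
        [/\ b' = b, c' = c &
            forall A : set (measurableTypeR R), measurable A -> nu' A = nu A])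
     /\
     [/\ limsup_root gamma =
           ereal_inf [set theta%:E | theta in [set theta : R | 0 <= theta /\
             exists alpha : R, 0 <= alpha /\
               forall n : nat, `|gamma n| <= alpha * theta ^+ n]],
         0 < c -> (1 <= limsup_root gamma)%E,
         msupport nu `<=`
           [set x : R | (- limsup_root gamma <= x%:E <= limsup_root gamma)%E],
         (1 <= sup_abs_support nu)%E -> limsup_root gamma = sup_abs_support nu &
         (limsup_root gamma <= Order.max 1 (sup_abs_support nu))%E]).
Proof.
split; [|split].
- split=> -[cpd].
    move=> [a [th [a0 th0 H]]]; split=> //; apply/limsup_root_lty.
    by exists th; split=> //; exists a.
  by move=> /limsup_root_lty [th [th0 [a [a0 H]]]]; split=> //; exists a, th.
- split=> [[cpd /limsup_root_lty [th gth]]|[b [c [nu H]]]].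
    exact: exists_represents gth.
  split; first exact: represents_cond_pos_def H.
  have [_ /compact_msupport_bounded [r r0 /msupport_bounded_by nur] _ _] := H.
  apply/limsup_root_lty; exists (Num.max 1 r + 1).
  by apply: (represents_growth_rates H nur); rewrite ltrDl.
move=> b c nu H; split=> [b' c' nu' H'|]; first exact: represents_unique H H'.
have suppL x := @msupport_limsup_root R gamma b c nu x H.
have L5 := limsup_root_le_max H.
split=> //.
- exact: limsup_rootE.
- exact: limsup_root_ge1 H.
- move=> x /suppL; rewrite /=; case: (limsup_root gamma) => [l||] //=.
    by rewrite !lee_fin ler_norml.
  by move=> _; rewrite leNye leey.
- move=> sup1; apply/eqP; rewrite eq_le; apply/andP; split.
    by move: L5; rewrite (max_idPr sup1).
  by apply/ereal_supP => _ [x nux <-]; exact: suppL.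
Qed.
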